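(* In classical mathematics, the following two definitions of ''real closed ring'' are equivalent. That is, a commutative ring $A$ admits a structure of model of the purely equational theory $\mathrm{Arc}$ if and only if it is real closed in the sense of Schwartz.
   Context: Rings are commutative with unit. **f-rings.** An f-ring is a commutative ring with a binary operation $\vee$ such that $x\vee x=x$, $x\vee y=y\vee x$, $(x\vee y)\vee z=x\vee(y\vee z)$, $x+(y\vee z)=(x+y)\vee(x+z)$ and $x^+(y\vee z)=(x^+y)\vee(x^+z)$, where $x^+:=x\vee 0$. One writes $x\wedge y:=-((-x)\vee(-y))$, $|x|:=x\vee(-x)$, and $x\ge y$ means $x\vee y=x$. **The theory $\mathrm{Arc}$.** A model is an f-ring $A$ with a binary operation $\mathrm{Fr}$ and operations $\rho_{d,j}$ of arity $d$ ($1\le j\le d$, ''virtual roots'') satisfying the following axioms. - (Fractions) $\mathrm{Fr}(a,b)\,|b|=(|a|\wedge|b|)^2$ and $0\le \mathrm{Fr}(a,b)\le |a|\wedge|b|$. (These make every integer $n\ge1$ invertible, so $A$ is a $\mathbb{Q}$-algebra.) - (vrsup) $\rho_{2,2}(a+b,-ab)=a\vee b$. - (Virtual roots) For a monic $f(X)=X^d-(a_{d-1}X^{d-1}+\cdots+a_0)$ write $\rho_{d,j}(f):=\rho_{d,j}(a_{d-1},\dots,a_0)$. Then $\rho_{1,1}(X-a)=a$. For $d\ge2$ let $g=f'/d$, $x=\rho_{d,j}(f)$, $\sigma=(-1)^{d-j}$, $\alpha=\rho_{d-1,j-1}(g)$ (if $j\ge2$), $\beta=\rho_{d-1,j}(g)$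 (if $j\le d-1$). The axioms are: - if $2\le j\le d-1$: $\alpha\le x\le\beta$, $\sigma(x-\alpha)f(\alpha)\le0$, $\sigma(\beta-x)f(\beta)\ge0$, $\sigma(x-\alpha)f(x)\le0$, $\sigma(\beta-x)f(x)\ge0$; - if $j=d$: $\alpha\le x$, $(x-\alpha)f(\alpha)\le0$, $(x-\alpha)f(x)\le0$, $f(x)\ge0$; - if $j=1$: $x\le\beta$, $\sigma(\beta-x)f(\beta)\ge0$, $\sigma(\beta-x)f(x)\ge0$, $\sigma f(x)\le0$. **Schwartz's definition.** A commutative ring $A$ is real closed if it is reduced and 1. the set of squares of $A$ is the set of elements $\ge0$ of a partial order on $A$ which makes $A$ an f-ring; 2. if $0\le a\le b$, there is $z\in A$ with $zb=a^2$; 3. for every prime ideal $\mathfrak p$, the residue ring $A/\mathfrak p$ is integrally closed (in its field of fractions) and its field of fractions is a real closed field. *)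

(* Defs.v *)
From HB Require Import structures.
From Stdlib Require Import Relation_Definitions.
From mathcomp Require Import all_boot all_order all_algebra.
From mathcomp Require Import boolp classical_sets.

Set Implicit Arguments.
Unset Strict Implicit.
Unset Printing Implicit Defensive.

Import GRing.Theory.
Local Open Scope ring_scope.

(* Rings have type comPzRingType: the trivial ring is allowed. *)

Section FRing.
Variables (A : comPzRingType) (vee : A -> A -> A).

Record is_fring : Prop := IsFRing {
  fring_veexx : idempotent_op vee;
  fring_veeC  : commutative vee;
  fring_veeA  : forall x y z, vee (vee x y) z = vee x (vee y z);
  fring_addDr : forall x y z, x + vee y z = vee (x + y) (x + z);
  fring_mulDr : forall x y z,
    vee x 0 * vee y z = vee (vee x 0 * y) (vee x 0 * z)
}.

Definition fmeet (x y : A) : A := - vee (- x) (- y).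
Definition fabs (x : A) : A := vee x (- x).
Definition fle (x y : A) : Prop := vee y x = y.

Section FRingTheory.
Hypothesis fr : is_fring.
Let veexx := fring_veexx fr.
Let veeC := fring_veeC fr.
Let veeA := fring_veeA fr.
Let addDr := fring_addDr fr.

Lemma fring_mulr_vee c y z : fle 0 c -> c * vee y z = vee (c * y) (c * z).
Proof. by move=> c0; have := fring_mulDr fr c y z; rewrite c0. Qed.

Lemma fring_oppr_le0 x : fle 0 x -> vee 0 (- x) = 0.
Proof.
by move=> x0; have := addDr (- x) x 0; rewrite x0 addNr addr0 => <-.
Qed.

Lemma fring_addr_ge0 x y : fle 0 x -> fle 0 y -> fle 0 (x + y).
Proof.
move=> x0 y0; have := addDr x y 0; rewrite y0 addr0 => e.
by rewrite /fle {1}e veeA x0 -e.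
Qed.

Lemma fring_mulr_ge0 x y : fle 0 x -> fle 0 y -> fle 0 (x * y).
Proof.
by move=> x0 y0; have := fring_mulr_vee y 0 x0; rewrite y0 mulr0 => e; symmetry.
Qed.

Lemma fring_ge01 : fle 0 1.
Proof.
pose p := vee 1 0; pose m := vee (-1) 0.
have vee0 x : fle 0 (vee x 0) by rewrite /fle veeA veexx.
have p0 : fle 0 p by exact: vee0.
have m0 : fle 0 m by exact: vee0.
have pE : p = 1 + m by rewrite /m addDr subrr addr0 veeC.
have pm : p * m = 0.
  have : p * vee m p = p * m + p.
    rewrite fring_mulr_vee // {3}pE mulrDr mulr1 [p + _]addrC -{1}[p * m]addr0.
    by rewrite -addDr veeC p0.
  have -> : vee m p = m + p.
    by rewrite {1}pE [1 + m]addrC -{1}[m]addr0 -addDr [vee 0 1]veeC.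
  have pp : p * p = p * m + p by rewrite {2}pE mulrDr mulr1 addrC.
  rewrite mulrDr pp => /eqP.
  by rewrite -subr_eq0 addrK => /eqP.
have mm : m * m = - m.
  apply/eqP; rewrite -addr_eq0 addrC -{1}[m]mul1r -mulrDl -pE.
  exact/eqP.
have mm0 : fle 0 (- m) by rewrite -mm; exact: fring_mulr_ge0.
have mE : m = 0.
  by have := fring_oppr_le0 m0; rewrite veeC mm0 => /eqP; rewrite oppr_eq0 => /eqP.
by rewrite /fle -/p pE mE addr0.
Qed.

Lemma fring_ge0n n : fle 0 n%:R.
Proof.
elim: n => [|n IH]; first by rewrite /fle veexx.
by rewrite -natr1; apply: fring_addr_ge0 => //; exact: fring_ge01.
Qed.

Lemma fabs_nat n : fabs n%:R = n%:R.
Proof.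
have n0 := fring_ge0n n.
by rewrite /fabs -{1}n0 veeA fring_oppr_le0.
Qed.

Lemma fmeet1n n : fmeet 1 n.+1%:R = 1.
Proof.
rewrite /fmeet -natr1 opprD [_ - 1]addrC -{1}[-1]addr0 -addDr.
by rewrite fring_oppr_le0 ?addr0 ?opprK //; exact: fring_ge0n.
Qed.

End FRingTheory.

End FRing.

(* A monic polynomial X^d - (a_{d-1} X^{d-1} + ... + a_0) is encoded by the   *)
(* tuple (a_{d-1}, ..., a_0): entry i is minus the coefficient of X^(d-1-i).  *)
(* ({poly A} would exclude the trivial ring.)                                 *)
Definition mpeval (A : comPzRingType) (d : nat) (a : d.-tuple A) (x : A) : A :=
  x ^+ d - \sum_(i < d) tnth a i * x ^+ (d.-1 - i).

(* rho d i stands for rho_{d,i+1}. *)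
Record arc_ops (A : comPzRingType) : Type := ArcOps {
  vee : A -> A -> A;
  Fr : A -> A -> A;
  rho : forall d : nat, 'I_d -> d.-tuple A -> A
}.

Section Arc.
Variables (A : comPzRingType) (S : arc_ops A).
Local Notation "x ∧ y" := (fmeet (vee S) x y) (at level 40).
Local Notation "∣ x ∣" := (fabs (vee S) x) (at level 35).
Local Notation "x ≤ y" := (fle (vee S) x y) (at level 70).
Local Notation rho := (rho S).

(* The tuple of f'/d for f of degree d = n + 2: the coefficient a_k of X^k    *)
(* becomes (k/d) a_k.  The term Fr(1,d) denotes the inverse of d, see         *)
(* Fr1nat below.                                                              *)
Definition mpderiv (n : nat) (a : n.+2.-tuple A) : n.+1.-tuple A :=
  [tuple Fr S 1 n.+2%:R * ((n.+1 - i)%:R * tnth a (widen_ord (leqnSn n.+1) i))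
    | i < n.+1].

Definition fractions_axiom : Prop := forall a b : A,
  [/\ Fr S a b * ∣b∣ = (∣a∣ ∧ ∣b∣) ^+ 2, 0 ≤ Fr S a b & Fr S a b ≤ ∣a∣ ∧ ∣b∣].

Definition vrsup_axiom : Prop := forall a b : A,
  @rho 2 ord_max [tuple a + b; - (a * b)] = vee S a b.

Definition vroot1_axiom : Prop := forall a : A, @rho 1 ord0 [tuple a] = a.

(* Here i = j - 1 satisfies 1 <= i <= d - 2. *)
Definition vroot_mid_axiom : Prop :=
  forall (n : nat) (a : n.+2.-tuple A) (i : 'I_n.+2), (0 < i < n.+1)%N ->
  let f := mpeval a in
  let x := rho i a in
  let s := (-1) ^+ (n.+1 - i) in
  let alpha := @rho n.+1 (inord i.-1) (mpderiv a) in
  let beta := @rho n.+1 (inord i) (mpderiv a) in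
  (alpha ≤ x /\ x ≤ beta) /\
  [/\ s * (x - alpha) * f alpha ≤ 0,
      0 ≤ s * (beta - x) * f beta,
      s * (x - alpha) * f x ≤ 0
    & 0 ≤ s * (beta - x) * f x].

Definition vroot_last_axiom : Prop :=
  forall (n : nat) (a : n.+2.-tuple A),
  let f := mpeval a in
  let x := rho ord_max a in
  let alpha := rho ord_max (mpderiv a) in
  [/\ alpha ≤ x,
      (x - alpha) * f alpha ≤ 0,
      (x - alpha) * f x ≤ 0
    & 0 ≤ f x].

Definition vroot_first_axiom : Prop :=
  forall (n : nat) (a : n.+2.-tuple A),
  let f := mpeval a in
  let x := rho ord0 a in
  let s := (-1) ^+ n.+1 in
  let beta := rho ord0 (mpderiv a) in
  [/\ x ≤ beta,
      0 ≤ s * (beta - x) * f beta,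
      0 ≤ s * (beta - x) * f x
    & s * f x ≤ 0].

Lemma Fr1nat (n : nat) : is_fring (vee S) -> fractions_axiom ->
  Fr S 1 n.+1%:R * n.+1%:R = 1.
Proof.
move=> fr /(_ 1 n.+1%:R) [+ _ _].
by rewrite (fabs_nat fr) -[1]/(1%:R) !(fabs_nat fr) (fmeet1n fr) expr1n.
Qed.

Record is_arc_model : Prop := IsArcModel {
  arc_fring : is_fring (vee S);
  arc_fractions : fractions_axiom;
  arc_vrsup : vrsup_axiom;
  arc_vroot1 : vroot1_axiom;
  arc_vroot_mid : vroot_mid_axiom;
  arc_vroot_last : vroot_last_axiom;
  arc_vroot_first : vroot_first_axiom
}.

End Arc.

Section Residue.
Variable A : comPzRingType.

Record prime_ideal (P : set A) : Prop := PrimeIdeal {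
  prime_ideal0 : P 0;
  prime_idealD : forall x y, P x -> P y -> P (x + y);
  prime_idealM : forall a x, P x -> P (a * x);
  prime_ideal1 : ~ P 1;
  prime_ideal_prime : forall x y, P (x * y) -> P x \/ P y
}.

Variables (P : set A) (hP : prime_ideal P).

Fact prime_ideal_oner_neq0 : 1 != 0 :> A.
Proof.
by apply/eqP=> e; apply: (prime_ideal1 hP); rewrite e; exact: prime_ideal0.
Qed.

(* {ideal_quot _} expects a nontrivial ring and a boolean ideal: A is        *)
(* nontrivial since 1 is not in P, and P is decided classically.              *)
Definition base_nz : comNzRingType :=
  HB.pack (GRing.ComPzRing.sort A) (GRing.PzSemiRing_isNonZero.Build A prime_ideal_oner_neq0).

Definition ideal_pred (x : base_nz) : bool := `[< P x >].

Fact ideal_pred_idealr : idealr_closed ideal_pred.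
Proof.
split; first by apply/asboolP; exact: prime_ideal0.
  by apply/asboolP; exact: prime_ideal1.
move=> a x y /asboolP Px /asboolP Py; apply/asboolP.
by apply: (prime_idealD hP) => //; exact: prime_idealM.
Qed.

Fact ideal_pred_prime : prime_idealr_closed ideal_pred.
Proof.
move=> x y /asboolP /(prime_ideal_prime hP) [] h; apply/orP; [left|right];
exact/asboolP.
Qed.

Definition residue_ideal : prime_idealr base_nz :=
  HB.pack ideal_pred (isIdealr.Build base_nz ideal_pred ideal_pred_idealr)
    (isPrimeIdealrClosed.Build base_nz ideal_pred ideal_pred_prime).

Definition residue_ring : comNzRingType := {ideal_quot residue_ideal}.

Definition residue_unit (x : residue_ring) : bool :=
  `[< exists y, y * x = 1 >].

Definition residue_inv (x : residue_ring) : residue_ring :=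
  if pselect (exists y, y * x = 1) is left h then projT1 (cid h) else x.

Fact residue_mulVx : {in residue_unit, left_inverse 1 residue_inv *%R}.
Proof.
move=> x /asboolP ux; rewrite /residue_inv.
by case: pselect => // h; case: cid.
Qed.

Fact residue_unitPl x y : y * x = 1 -> residue_unit x.
Proof. by move=> yx; apply/asboolP; exists y. Qed.

Fact residue_inv_out : {in [predC residue_unit], residue_inv =1 id}.
Proof.
move=> x /asboolPn ux; rewrite /residue_inv.
by case: pselect.
Qed.

Fact residue_integral : GRing.integral_domain_axiom residue_ring.
Proof. by move=> x y; exact: Quotient.rquot_IdomainAxiom. Qed.

Definition residue_unit_ring : comUnitRingType :=
  HB.pack (GRing.ComNzRing.sort residue_ring)
    (GRing.ComNzRing_hasMulInverse.Build residue_ring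
       residue_mulVx residue_unitPl residue_inv_out).

Definition residue_domain : idomainType :=
  HB.pack (GRing.ComUnitRing.sort residue_unit_ring)
    (GRing.ComUnitRing_isIntegral.Build residue_unit_ring residue_integral).

Definition residue_field : fieldType := {fraction residue_domain}.

End Residue.

Section ResidueTheory.
Local Open Scope quotient_scope.
Variables (A : comPzRingType) (P : set A) (hP : prime_ideal P).

Definition residue (a : A) : residue_domain hP :=
  \pi_(Quotient.quot (residue_ideal hP)) (a : base_nz hP).

Fact residue_is_zmod_morphism : zmod_morphism residue.
Proof. by move=> x y; rewrite /residue; exact: rmorphB. Qed.

Fact residue_is_monoid_morphism : monoid_morphism residue.
Proof. by split=> [|x y]; [exact: rmorph1 | exact: rmorphM]. Qed.

HB.instance Definition _ :=
  GRing.isZmodMorphism.Build A (residue_domain hP) residue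
    residue_is_zmod_morphism.
HB.instance Definition _ :=
  GRing.isMonoidMorphism.Build A (residue_domain hP) residue
    residue_is_monoid_morphism.

Lemma residue_surj (x : residue_domain hP) : exists a, residue a = x.
Proof. by exists (repr (x : residue_ring hP)); exact: reprK. Qed.

Lemma residue_eq0 a : residue a = 0 <-> P a.
Proof.
have := @Quotient.idealrBE (base_nz hP) (residue_ideal hP) a 0.
rewrite subr0 => e; change (`[< P a >] = (residue a == residue 0)) in e.
rewrite rmorph0 in e.
split=> [h|Pa]; first by apply/asboolP; rewrite e; exact/eqP.
by apply/eqP; rewrite -e; exact/asboolP.
Qed.

End ResidueTheory.

Definition integrally_closed (D : idomainType) : Prop :=
  forall z : {fraction D}, integralOver (@FracField.tofrac D) z ->
  exists x : D, FracField.tofrac x = z.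

(* The ordering of a real closed field is determined by its field structure,  *)
(* so that being real closed is a property of the bare field K.               *)
Definition real_closed_field (K : fieldType) : Prop :=
  exists (R : rcfType) (f : {rmorphism K -> R}), bijective f.

Section Schwartz.
Variable A : comPzRingType.

Definition reduced : Prop := forall (x : A) (n : nat), x ^+ n = 0 -> x = 0.

Definition fring_order (le : A -> A -> Prop) : Prop :=
  Relation_Definitions.order A le /\
  exists2 v : A -> A -> A, is_fring v & forall x y, le x y <-> fle v x y.

Record schwartz_real_closed : Prop := SchwartzRealClosed {
  schwartz_reduced : reduced;
  schwartz_order : exists le : A -> A -> Prop,
    [/\ fring_order le,
        forall x, le 0 x <-> exists y, x = y ^+ 2
      & forall a b, le 0 a -> le a b -> exists z, z * b = a ^+ 2];
  schwartz_residue : forall (P : set A) (hP : prime_ideal P),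
    integrally_closed (residue_domain hP) /\
    real_closed_field (residue_field hP)
}.

End Schwartz.

(* Main.v *)
Require Import Defs.
From HB Require Import structures.
From mathcomp Require Import all_boot all_order all_algebra.
From mathcomp Require Import ring lra polyrcf.
From mathcomp Require Import boolp classical_sets.

Set Implicit Arguments.
Unset Strict Implicit.
Unset Printing Implicit Defensive.

Import Order.TTheory GRing.Theory Num.Theory.
Local Open Scope ring_scope.

(** Both directions rest on the behaviour of virtual roots over an ordered
field [K] mapped into by the ring.  Write [f] for a monic polynomial of degree
[d], [r_1 <= ... <= r_d] for its virtual roots, and [g = f'/d].  By induction
on [d], the sign of [f] on the open interval between [r_k] and [r_(k+1)] is
[(-1)^(d-k)] ([vroots_cell_signs]): on a cell of the virtual roots of [g] the
sign of [g] is known, so [f] is strictly monotone there ([mpeval_incr]), and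
the axioms fix the sign of [f] at the virtual root of that cell.  Three
consequences follow: the virtual roots are unique ([vroot_uniq]), every root
of [f] is one of them ([root_in_vroots]), and [f] has the intermediate value
property ([cell_signs_ivt]).  The passage from the sign of [g] to the
monotonicity of [f] uses intermediate values in degree less than [d] only, so
the argument applies to a field [K] that is not yet known to be real closed.

From a model of Arc to a real closed ring.  The polynomial with roots [x] and
[-x] depends only on [x^2], so vrsup gives [|x| = |0|] if [x^2 = 0]: the ring
is reduced.  The last virtual root of [X^2 - a] is a square root of
[a >= 0].  Fractions make every prime ideal [P] convex, so [Frac(A/P)] is
ordered with its squares as the nonnegative elements.  The virtual roots of
[A] specialize to this field, which therefore has the intermediate value
property in every degree ([arc_ivt]) and is real closed; a root in it of a
monic polynomial over [A/P] is a virtual root, hence lies in [A/P]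
([arc_integral]).

From a real closed ring to a model of Arc.  An element is nonnegative iff it
is so in every residue field, so fractions and vrsup are checked pointwise.
Given the virtual roots of [g], the conditions on [x] to be a virtual root of
[f] are inequalities, which hold modulo [P] iff one element [Y x] is in [P].
Every [P] has a solution: in the real closed field [Frac(A/P)] there is one
that is an end of the cell or a root of [f] ([vroot_exists]), and it is in
[A/P] because [A/P] is integrally closed.  The local solutions are glued
([glue]): finitely many suffice, since otherwise some prime ideal avoids all
the [Y x]; and two of them, which agree modulo every prime ideal that contains
both [Y x] and [Y y], come from a common element because the sum of two
radical convex ideals is radical ([ideal_sum_radical]). *)

(** * Polynomials over an ordered field with limited intermediate values *)

Section LimitedIVT.
Variable K : realFieldType.
Implicit Types (p q : {poly K}) (a b : K).

(** Degrees are bounded because the fields below are shown to be real closed by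
induction on the degree. *)
Definition ivt_upto (n : nat) : Prop := forall p, (size p <= n)%N ->
  forall a b, a < b -> p.[a] * p.[b] < 0 -> exists2 c, a < c < b & root p c.

Lemma ivt_uptoW m n : (m <= n)%N -> ivt_upto n -> ivt_upto m.
Proof. by move=> mn h p /leq_trans sp; apply: h; exact: sp. Qed.

(** Continuity at [a]: in [p.[z] = p.[a] + (z - a) * q.[z]], the factor [q.[z]]
is bounded on the interval. *)
Lemma poly_lt0_right p a b : a < b -> p.[a] < 0 ->
  exists2 z, a < z < b & p.[z] < 0.
Proof.
move=> ab pa.
have /factor_theorem [q pE] : root (p - p.[a]%:P) a.
  by rewrite rootE hornerD hornerN hornerC subrr.
have pzE z : p.[z] = p.[a] + q.[z] * (z - a).
  by rewrite -[p in LHS](subrK p.[a]%:P) pE !hornerE addrC.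
have [M hM] := poly_itv_bound q a b.
have M0 : 0 <= M by apply: le_trans (hM a _) => //; rewrite lexx ltW.
(* The step is small enough that [e * (M + 1) < - p.[a]]. *)
pose e := Num.min ((b - a) / 2) (- p.[a] / (M + 1) / 2).
have M1 : 0 < M + 1 by lra.
have pM : 0 < - p.[a] / (M + 1) by rewrite divr_gt0 // oppr_gt0.
have e0 : 0 < e by rewrite lt_min; apply/andP; split; lra.
have eb : e <= (b - a) / 2 by rewrite ge_min lexx.
have ep : e < - p.[a] / (M + 1).
  have : e <= - p.[a] / (M + 1) / 2 by rewrite ge_min lexx orbT.
  lra.
exists (a + e); first by apply/andP; split; lra.
have := hM (a + e); rewrite pzE addrAC subrr add0r => h.
have {}h : `|q.[a + e]| <= M by apply: h; apply/andP; split; lra.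
have : e * (M + 1) < - p.[a] by rewrite -ltr_pdivlMr.
have : q.[a + e] * e <= M * e.
  by rewrite ler_wpM2r ?(ltW e0)//; apply: le_trans h; exact: ler_norm.
nra.
Qed.

Lemma poly_lt0_left p a b : a < b -> p.[b] < 0 ->
  exists2 z, a < z < b & p.[z] < 0.
Proof.
move=> ab pb; have [||z /andP[z1 z2] pz] := @poly_lt0_right (p \Po - 'X) (- b) (- a).
- by rewrite ltrN2.
- by rewrite horner_comp !hornerE opprK.
exists (- z); first by rewrite ltrNr z2 ltrNl z1.
by move: pz; rewrite horner_comp !hornerE.
Qed.

(** If [q = (X - c) r] has positive derivative [r.[c]] at a root [c], then [r] is
negative at [a] and positive at [c], and the statement for [- r] on [[a, c]]
yields a smaller root of [q] at which the derivative has the right sign. *)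
Lemma root_deriv_le0 q a b : ivt_upto (size q) -> a < b ->
  0 < q.[a] -> q.[b] <= 0 -> exists c, [/\ a < c, c <= b, root q c & q^`().[c] <= 0].
Proof.
have [n] := ubnP (size q); elim: n => // n IH in q a b *.
rewrite ltnS => sq ivt ab qa qb.
have [c [ac cb rc]] : exists c, [/\ a < c, c <= b & root q c].
  have [qb0|qb0] := eqVneq q.[b] 0; first by exists b; split=> //; exact/rootP.
  have [|c /andP[ac cb] rc] := ivt q (leqnn _) a b ab.
    by rewrite nmulr_llt0 // lt_neqAle qb0.
  by exists c; rewrite (ltW cb).
have [r qE] := factor_theorem q c rc.
have q0 : q != 0 by apply/eqP=> e; move: qa; rewrite e horner0 ltxx.
have r0 : r != 0 by apply: contra_neq q0 => r0; rewrite qE r0 mul0r.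
have sE : size q = (size r).+1 by rewrite qE size_Mmonic ?monicXsubC // size_XsubC addn2.
have dq x : q^`().[x] = r^`().[x] * (x - c) + r.[x].
  by rewrite qE derivM derivXsubC !hornerE.
have [dc|dc] := lerP q^`().[c] 0; first by exists c.
move: dc; rewrite dq subrr mulr0 add0r => rc0.
have ra : r.[a] < 0.
  by move: qa; rewrite qE !hornerE nmulr_lgt0 // subr_lt0.
have [||||| c' [ac' cc' rc' dc']] := IH (- r) a c.
- by rewrite size_polyN -ltnS -sE.
- by apply: ivt_uptoW ivt; rewrite size_polyN sE.
- by [].
- by rewrite hornerN oppr_gt0.
- by rewrite hornerN oppr_le0 ltW.
move: rc'; rewrite rootN => rc'.
exists c'; split => //; first exact: le_trans cb.
  by rewrite qE rootM rc'.
rewrite dq (rootP rc') addr0; move: dc'; rewrite derivN hornerN oppr_le0 => dc'.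
by rewrite mulr_ge0_le0 // subr_le0.
Qed.

(** With [p - p.[a] = (X - a) q], the derivative of [p] at a root [c] of [q] is
[(c - a) q'.[c]]; if [p.[b] <= p.[a]], then [q] passes from positive to
nonpositive and [root_deriv_le0] provides a root with [q'.[c] <= 0].  Only
intermediate values of [q], of degree one less, are used. *)
Lemma poly_incr_closed p n a b : (size p <= n.+1)%N -> ivt_upto n -> a < b ->
  (forall z, a <= z <= b -> 0 < p^`().[z]) -> p.[a] < p.[b].
Proof.
move=> sp ivt ab dp; rewrite ltNge; apply/negP => pba.
have /factor_theorem [q pE] : root (p - p.[a]%:P) a.
  by rewrite rootE hornerD hornerN hornerC subrr.
have pzE z : p.[z] = p.[a] + q.[z] * (z - a).
  by rewrite -[p in LHS](subrK p.[a]%:P) pE !hornerE addrC.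
have dpE z : p^`().[z] = q^`().[z] * (z - a) + q.[z].
  rewrite -[p in LHS](subrK p.[a]%:P) pE derivD derivC addr0 derivM derivXsubC.
  by rewrite !hornerE.
have sq : (size q <= n)%N.
  have [->|q0] := eqVneq q 0; first by rewrite size_poly0.
  rewrite -ltnS; apply: leq_trans sp.
  have -> : (size q).+1 = size (p - p.[a]%:P).
    by rewrite pE size_Mmonic ?monicXsubC // size_XsubC addn2.
  apply: leq_trans (size_polyD _ _) _; rewrite size_polyN geq_max leqnn /=.
  have [->|pn0] := eqVneq p 0; first by rewrite horner0 size_poly0.
  by apply: leq_trans (size_polyC_leq1 _) _; rewrite lt0n size_poly_eq0.
have qa : 0 < q.[a].
  by have := dp a; rewrite dpE subrr mulr0 add0r; apply; rewrite lexx ltW.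
have qb : q.[b] <= 0.
  by move: pba; rewrite pzE gerDl pmulr_lle0 // subr_gt0.
have [c [ac cb rc dc]] := root_deriv_le0 (ivt_uptoW sq ivt) ab qa qb.
have := dp c; rewrite dpE (rootP rc) addr0 (ltW ac) cb => /(_ isT).
by rewrite ltNge mulr_le0_ge0 // subr_ge0 ltW.
Qed.

(** The derivative may vanish at [a] and [b]; strict monotonicity inside extends
to the ends by continuity. *)
Lemma poly_incr p n a b : (size p <= n.+1)%N -> ivt_upto n -> a < b ->
  (forall z, a < z < b -> 0 < p^`().[z]) -> p.[a] < p.[b].
Proof.
move=> sp ivt ab dp.
have mono x y : a < x -> x < y -> y < b -> p.[x] < p.[y].
  move=> ax xy yb; apply: poly_incr_closed sp ivt xy _ => z /andP[xz zy].
  by apply: dp; rewrite (lt_le_trans ax xz) (le_lt_trans zy yb).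
pose u := a + (b - a) / 3; pose v := a + (b - a) * 2 / 3.
have au : a < u by rewrite /u; lra.
have uv : u < v by rewrite /u /v; lra.
have vb : v < b by rewrite /v; lra.
have pau : p.[a] <= p.[u].
  rewrite leNgt; apply/negP => pua.
  have [|z /andP[az zu]] := @poly_lt0_right (p.[u]%:P - p) a u au.
    by rewrite !hornerE subr_lt0.
  rewrite !hornerE subr_lt0 => h.
  by have := mono z u az zu (lt_trans uv vb); rewrite ltNge (ltW h).
have pvb : p.[v] <= p.[b].
  rewrite leNgt; apply/negP => pbv.
  have [|z /andP[vz zb]] := @poly_lt0_left (p - p.[v]%:P) v b vb.
    by rewrite !hornerE subr_lt0.
  rewrite !hornerE subr_lt0 => h.
  by have := mono v z (lt_trans au uv) vz zb; rewrite ltNge (ltW h).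
exact: le_lt_trans pau (lt_le_trans (mono u v au uv vb) pvb).
Qed.

End LimitedIVT.

(** * Virtual roots over a ring and over an ordered field *)

(** [lo_bound s j] and [onth s j] are the ends of the [j]-th of the cells into
which [s] cuts the line; [None] stands for an infinite end. *)
Definition lo_bound (T : Type) (s : seq T) (j : nat) : option T :=
  if j is i.+1 then onth s i else None.

Section VirtualRoots.
Variable T : comPzRingType.

(** The elements that the virtual root axioms require to be nonnegative, for a
virtual root [x] of [f] in the cell from [lo] to [hi], with [s] the sign
attached to the cell.  At an infinite end, the three conditions of a finite
end reduce to one sign condition on [f x]: this gives the three groups of
axioms a common form. *)
Definition cell_conds (s : T) (f : T -> T) (lo hi : option T) (x : T) : seq T :=
  (if lo is Some a then [:: x - a; - (s * (x - a) * f a); - (s * (x - a) * f x)]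
   else [:: - (s * f x)]) ++
  (if hi is Some b then [:: b - x; s * (b - x) * f b; s * (b - x) * f x]
   else [:: s * f x]).

Definition vroot_conds n (a : n.+1.-tuple T) (rs : seq T) (j : nat) : T -> seq T :=
  cell_conds ((-1) ^+ (n - j)) (mpeval a) (lo_bound rs j) (onth rs j).

(** [b] represents [f'/d] for the [f] of degree [d = n + 1] represented by [a].
Stating this without division lets it pass along ring morphisms. *)
Definition is_mpderiv n (a : n.+1.-tuple T) (b : n.-tuple T) : Prop :=
  forall i : 'I_n,
  n.+1%:R * tnth b i = (n - i)%:R * tnth a (widen_ord (leqnSn n) i).

Definition all_pos (pos : T -> Prop) (us : seq T) : Prop :=
  forall u, u \in us -> pos u.

(** [rs] is the sequence of virtual roots of [a] if [pos] is nonnegativity.  The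
virtual roots of the derivatives are quantified existentially, so that the
predicate refers to no choice of root functions and can be transferred. *)
Fixpoint vroots (pos : T -> Prop) d : d.-tuple T -> seq T -> Prop :=
  if d is n.+1 then fun a rs =>
    size rs = n.+1 /\ exists b ss, [/\ is_mpderiv a b, vroots pos b ss
      & forall j, (j < n.+1)%N -> all_pos pos (vroot_conds a ss j (nth 0 rs j))]
  else fun _ rs => rs = [::].

Lemma size_vroots pos d (a : d.-tuple T) rs : vroots pos a rs -> size rs = d.
Proof. by case: d a => [|n] a => [-> //|[]]. Qed.

Lemma all_pos_cat pos us vs :
  all_pos pos (us ++ vs) <-> all_pos pos us /\ all_pos pos vs.
Proof.
split=> [h|[hu hv] w].
  by split=> w hw; apply: h; rewrite mem_cat hw ?orbT.
by rewrite mem_cat => /orP[/hu|/hv].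
Qed.

Lemma all_pos1 pos u : all_pos pos [:: u] <-> pos u.
Proof.
by split=> [h|h v]; [apply: h; rewrite mem_head | rewrite inE => /eqP->].
Qed.

Lemma all_pos3 pos u v w :
  all_pos pos [:: u; v; w] <-> [/\ pos u, pos v & pos w].
Proof.
split=> [h|[hu hv hw] x].
  by split; apply: h; rewrite !inE eqxx ?orbT.
by rewrite !inE => /or3P[] /eqP->.
Qed.

End VirtualRoots.

Section Transfer.
Variables (T U : comPzRingType) (phi : {rmorphism T -> U}).

Lemma mpeval_map d (a : d.-tuple T) x :
  phi (mpeval a x) = mpeval (map_tuple phi a) (phi x).
Proof.
rewrite /mpeval rmorphB rmorphXn rmorph_sum; congr (_ - _).
by apply: eq_bigr => i _; rewrite rmorphM rmorphXn tnth_map.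
Qed.

Lemma is_mpderiv_map n (a : n.+1.-tuple T) b :
  is_mpderiv a b -> is_mpderiv (map_tuple phi a) (map_tuple phi b).
Proof.
move=> h i; rewrite !tnth_map -(rmorph_nat phi) -rmorphM h.
by rewrite rmorphM rmorph_nat.
Qed.

Lemma lo_bound_map (V W : Type) (f : V -> W) s j :
  lo_bound (map f s) j = omap f (lo_bound s j).
Proof. by case: j => //= j; rewrite onth_map. Qed.

Lemma vroot_conds_map n (a : n.+1.-tuple T) rs j x :
  map phi (vroot_conds a rs j x) =
  vroot_conds (map_tuple phi a) (map phi rs) j (phi x).
Proof.
rewrite /vroot_conds lo_bound_map onth_map /cell_conds map_cat.
have sE : phi ((-1) ^+ (n - j)) = (-1) ^+ (n - j) by rewrite rmorphXn rmorphN1.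
by case: (lo_bound _ _) => [u|]; case: (onth _ _) => [v|] /=;
  rewrite !(mpeval_map, rmorphN, rmorphB, rmorphM, sE).
Qed.

Variables (posT : T -> Prop) (posU : U -> Prop).
Hypothesis phi_pos : forall u, posT u -> posU (phi u).

Lemma vroots_map d (a : d.-tuple T) rs :
  vroots posT a rs -> vroots posU (map_tuple phi a) (map phi rs).
Proof.
elim: d a rs => [|n IH] a rs /=; first by move->.
case=> srs [b [ss [ab hb h]]]; split; first by rewrite size_map.
exists (map_tuple phi b), (map phi ss); split; [exact: is_mpderiv_map|exact: IH|].
move=> j jn; rewrite (nth_map 0) ?srs // -vroot_conds_map => u /mapP[v hv ->].
exact: phi_pos (h j jn v hv).
Qed.

End Transfer.

Section MonicPoly.
Variable R : comNzRingType.

Definition mpoly_of d (a : d.-tuple R) : {poly R} :=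
  'X^d - \sum_(i < d) tnth a i *: 'X^(d.-1 - i).

Lemma horner_mpoly_of d (a : d.-tuple R) x : (mpoly_of a).[x] = mpeval a x.
Proof.
rewrite /mpoly_of /mpeval hornerD hornerN horner_sum hornerXn; congr (_ - _).
by apply: eq_bigr => i _; rewrite hornerZ hornerXn.
Qed.

Lemma size_mpoly_of_tail d (a : d.-tuple R) :
  (size (- \sum_(i < d) tnth a i *: 'X^(d.-1 - i) : {poly R})%R < size ('X^d : {poly R}))%N.
Proof.
rewrite size_polyN size_polyXn ltnS.
apply: (big_ind (fun p : {poly R} => (size p <= d)%N)) => [|p q hp hq|i _].
- by rewrite size_poly0.
- by apply: leq_trans (size_polyD _ _) _; rewrite geq_max hp.
apply: leq_trans (size_scale_leq _ _) _; rewrite size_polyXn.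
by case: d i {a} => [[]|d] i //=; rewrite ltnS leq_subr.
Qed.

Lemma size_mpoly_of d (a : d.-tuple R) : size (mpoly_of a) = d.+1.
Proof. by rewrite /mpoly_of size_polyDl ?size_mpoly_of_tail // size_polyXn. Qed.

Lemma monic_mpoly_of d (a : d.-tuple R) : mpoly_of a \is monic.
Proof.
by rewrite monicE /mpoly_of lead_coefDl ?size_mpoly_of_tail // lead_coefXn.
Qed.

Lemma deriv_mpoly_of n (a : n.+1.-tuple R) b : is_mpderiv a b ->
  (mpoly_of a)^`() = n.+1%:R *: mpoly_of b.
Proof.
move=> ab; rewrite /mpoly_of derivB derivXn raddf_sum big_ord_recr /=.
rewrite derivZ subnn derivXn mulr0n scaler0 addr0 scalerBr scaler_nat.
congr (_ - _); rewrite scaler_sumr; apply: eq_bigr => i _.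
rewrite derivZ derivXn scalerA ab [_ * tnth _ _]mulrC -scalerA scaler_nat.
by rewrite -subn1 subnAC subn1.
Qed.

End MonicPoly.

Lemma map_mpoly_of (R U : comNzRingType) (f : {rmorphism R -> U}) d (a : d.-tuple R) :
  map_poly f (mpoly_of a) = mpoly_of (map_tuple f a).
Proof.
rewrite /mpoly_of rmorphB rmorph_sum /= map_polyXn; congr (_ - _).
by apply: eq_bigr => i _; rewrite map_polyZ map_polyXn tnth_map.
Qed.

Section VirtualRootsField.
Variable K : realFieldType.

Local Notation vrootsK := (@vroots K (fun u : K => 0 <= u)).
Local Notation pos := (fun u : K => 0 <= u).

Definition in_cell (lo hi : option K) (z : K) : bool :=
  (if lo is Some a then a < z else true) && (if hi is Some b then z < b else true).

(** The sign of [f] on the open [k]-th cell of [rs] is that of the product of the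
[X - r], for [r] in a sorted [rs] of size [d]. *)
Definition cell_signs d (a : d.-tuple K) (rs : seq K) : Prop :=
  forall k z, (k <= d)%N -> in_cell (lo_bound rs k) (onth rs k) z ->
  0 < (-1) ^+ (d - k) * mpeval a z.

Definition le_cell (lo hi : option K) (u v : K) : bool :=
  (if lo is Some a then a <= u else true) && (if hi is Some b then v <= b else true).

(** The derivative is [n + 1] times the polynomial of [b], whose sign on the cell
is known. *)
Lemma mpeval_incr n (a : n.+1.-tuple K) b ss j u v : is_mpderiv a b ->
  cell_signs b ss -> ivt_upto K n.+1 -> (j <= n)%N ->
  le_cell (lo_bound ss j) (onth ss j) u v -> u < v ->
  (-1) ^+ (n - j) * mpeval a u < (-1) ^+ (n - j) * mpeval a v.
Proof.
move=> ab sg ivt jn cl uv.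
have := @poly_incr K ((-1) ^+ (n - j) *: mpoly_of a) n.+1 u v.
rewrite !hornerZ !horner_mpoly_of; apply=> //.
  by apply: leq_trans (size_scale_leq _ _) _; rewrite size_mpoly_of.
move=> z /andP[uz zv]; rewrite derivZ (deriv_mpoly_of ab) !hornerZ horner_mpoly_of.
rewrite mulrCA mulr_gt0 ?ltr0n //; apply: sg => //.
move: cl => /andP[lu vh]; apply/andP; split.
  by move: lu; case: (lo_bound _ _) => // w /le_lt_trans; apply.
by move: vh; case: (onth _ _) => // w; apply: lt_le_trans.
Qed.

Lemma vroot_lo_le (s : K) f lo hi x : all_pos pos (cell_conds s f (Some lo) hi x) ->
  lo <= x.
Proof. by move=> /all_pos_cat[/all_pos3[]]; rewrite subr_ge0. Qed.

Lemma vroot_le_hi (s : K) f lo hi x : all_pos pos (cell_conds s f lo (Some hi) x) ->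
  x <= hi.
Proof. by move=> /all_pos_cat[_ /all_pos3[]]; rewrite subr_ge0. Qed.

Lemma vroot_le0 (s : K) f lo hi x : all_pos pos (cell_conds s f lo hi x) ->
  (if lo is Some a then a < x else true) -> s * f x <= 0.
Proof.
move=> /all_pos_cat[+ _]; case: lo => [w|]; last first.
  by move=> /all_pos1; rewrite oppr_ge0.
move=> /all_pos3[_ _]; rewrite oppr_ge0 mulrAC => h wx.
by move: h; rewrite pmulr_lle0 // subr_gt0.
Qed.

Lemma vroot_ge0 (s : K) f lo hi x : all_pos pos (cell_conds s f lo hi x) ->
  (if hi is Some b then x < b else true) -> 0 <= s * f x.
Proof.
move=> /all_pos_cat[_]; case: hi => [w|]; last by move=> /all_pos1.
by move=> /all_pos3[_ _]; rewrite mulrAC => h wx; move: h; rewrite pmulr_lge0 // subr_gt0.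
Qed.

Lemma le_cell_lo (s : K) f lo hi x z : all_pos pos (cell_conds s f lo hi x) ->
  (if hi is Some b then z <= b else true) -> le_cell lo hi x z.
Proof.
move=> h zh; rewrite /le_cell zh andbT.
by case: lo h => // lo; apply: vroot_lo_le.
Qed.

Lemma le_cell_hi (s : K) f lo hi x z : all_pos pos (cell_conds s f lo hi x) ->
  (if lo is Some a then a <= z else true) -> le_cell lo hi z x.
Proof.
move=> h zh; rewrite /le_cell zh /=.
by case: hi h => // hi; apply: vroot_le_hi.
Qed.

Lemma onth_ltn (T : Type) (x0 : T) s i : (i < size s)%N -> onth s i = Some (nth x0 s i).
Proof. by move=> h; rewrite onthE (nth_map x0). Qed.

(** If [r] and [r'] are the consecutive virtual roots around [z], the virtual root
[w] of [f'/d] between them satisfies [r <= w <= r'].  If [z <= w], then [z] and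
[r] are in a common cell of the derivative, and [f] at [z] is compared with
[f] at [r]; otherwise with [f] at [r']. *)
Lemma vroots_cell_signs d (a : d.-tuple K) rs :
  ivt_upto K d -> vrootsK a rs -> cell_signs a rs.
Proof.
elim: d a rs => [|n IH] a rs ivt /=.
  move=> _ k z; rewrite leqn0 => /eqP-> _.
  by rewrite /mpeval big_ord0 subr0 expr0 mulr1 subnn expr0 ltr01.
case=> srs [b [ss [ab hb hrs]]] k z kn.
have sg : cell_signs b ss by apply: IH => //; apply: ivt_uptoW ivt.
have sss := size_vroots hb.
move=> /andP[zlo zhi].
(* [w] is the virtual root of the derivative between those around [z]. *)
have [below|] := boolP ((0 < k)%N &&
    (if onth ss k.-1 is Some w then z <= w else true)).
  case: k kn zlo zhi below => // k kn /= zlo zhi zw.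
  rewrite subSS.
  have kr : (k < size rs)%N by rewrite srs.
  rewrite (onth_ltn 0 kr) in zlo.
  have hk := hrs k kn; have cl := le_cell_lo hk zw.
  have := mpeval_incr ab sg ivt kn cl zlo; apply: le_lt_trans.
  apply: vroot_ge0 hk _.
  by case: (onth ss k) zw => // w; apply: lt_le_trans.
rewrite negb_and => above.
have {}kn : (k < n.+1)%N.
  rewrite ltn_neqAle kn andbT; apply/eqP => kE; move: above; rewrite kE /=.
  by rewrite onth_default ?sss.
have kr : (k < size rs)%N by rewrite srs.
rewrite (onth_ltn 0 kr) in zhi.
have hk := hrs k kn.
have zw : if lo_bound ss k is Some w then w < z else true.
  case: k above {kn kr zlo zhi hk} => //= k.
  by case: (onth ss k) => // w; rewrite -ltNge.
have cl : le_cell (lo_bound ss k) (onth ss k) z (nth 0 rs k).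
  by apply: le_cell_hi hk _; case: (lo_bound ss k) zw => // w; apply: ltW.
have lt := mpeval_incr ab sg ivt kn cl zhi.
rewrite subSn // exprS mulN1r mulNr oppr_gt0; apply: lt_le_trans lt _.
apply: vroot_le0 hk _.
by case: (lo_bound ss k) zw => // w wz; apply: lt_trans wz zhi.
Qed.

(** If [x < y] were two solutions, then [s * f] would be nonnegative at [x], which
is not the upper end, nonpositive at [y], which is not the lower end, and
strictly increasing. *)
Lemma vroot_uniq n (a : n.+1.-tuple K) b ss j x y : is_mpderiv a b ->
  cell_signs b ss -> ivt_upto K n.+1 -> (j <= n)%N ->
  all_pos pos (vroot_conds a ss j x) -> all_pos pos (vroot_conds a ss j y) -> x = y.
Proof.
move=> ab sg ivt jn.
wlog xy : x y / x < y.
  move=> h hx hy; have [xy|yx|//] := ltgtP x y; first exact: h.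
  by symmetry; apply: h.
rewrite /vroot_conds => hx hy.
have cl : le_cell (lo_bound ss j) (onth ss j) x y.
  apply: le_cell_lo hx _; case: (onth ss j) hy => // w hy.
  exact: vroot_le_hi hy.
have := mpeval_incr ab sg ivt jn cl xy.
have fx : 0 <= (-1) ^+ (n - j) * mpeval a x.
  apply: vroot_ge0 hx _; case: (onth ss j) hy => // w hy.
  exact: lt_le_trans xy (vroot_le_hi hy).
have fy : (-1) ^+ (n - j) * mpeval a y <= 0.
  apply: vroot_le0 hy _; case: (lo_bound ss j) hx => // w hx.
  exact: le_lt_trans (vroot_lo_le hx) xy.
by rewrite ltNge (le_trans fy fx).
Qed.

Lemma is_mpderiv_uniq n (a : n.+1.-tuple K) b b' :
  is_mpderiv a b -> is_mpderiv a b' -> b = b'.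
Proof.
move=> h h'; apply: eq_from_tnth => i.
have : n.+1%:R * tnth b i = n.+1%:R * tnth b' i by rewrite h h'.
by apply: mulfI; rewrite pnatr_eq0.
Qed.

Lemma vroots_uniq d (a : d.-tuple K) rs rs' : ivt_upto K d ->
  vrootsK a rs -> vrootsK a rs' -> rs = rs'.
Proof.
elim: d a rs rs' => [|n IH] a rs rs' ivt /=; first by move=> -> ->.
case=> srs [b [ss [ab hb h]]] [srs' [b' [ss' [ab' hb' h']]]].
have ivtn : ivt_upto K n by apply: ivt_uptoW ivt.
move: hb' h'; rewrite -(is_mpderiv_uniq ab ab') => hb'.
rewrite -(IH b ss ss' ivtn hb hb') => h'.
have sg := vroots_cell_signs ivtn hb.
apply: (@eq_from_nth _ 0); first by rewrite srs srs'.
by rewrite srs => j jn; apply: vroot_uniq (h j jn) (h' j jn).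
Qed.

(** Outside of [rs], a point is in an open cell: the one that ends at the first
[r] not below it. *)
Lemma cell_find rs (z : K) (k := find (fun r => z <= r) rs) :
  z \notin rs -> in_cell (lo_bound rs k) (onth rs k) z.
Proof.
move=> zrs; apply/andP; split.
  case E: k => [//|i] /=.
  have ik : (i < k)%N by rewrite E.
  have irs : (i < size rs)%N by apply: leq_trans ik (find_size _ _).
  by rewrite (onth_ltn 0 irs) ltNge (before_find 0 ik).
have [zr|zr] := boolP (has (fun r => z <= r) rs).
  rewrite (onth_ltn 0) /k -?has_find //.
  rewrite lt_neqAle (nth_find 0 zr) andbT; apply: contraNneq zrs => ->.
  by rewrite mem_nth // -has_find.
by rewrite onth_default // /k hasNfind.
Qed.

(** The sign of [f] in the open cells is not zero. *)
Lemma root_in_vroots d (a : d.-tuple K) rs z : ivt_upto K d ->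
  vrootsK a rs -> mpeval a z = 0 -> z \in rs.
Proof.
move=> ivt h fz; apply: contraT => zrs.
have := vroots_cell_signs ivt h _ (cell_find zrs).
by rewrite fz mulr0 ltxx -(size_vroots h) find_size => /(_ isT).
Qed.

(** Bisection at the points of [rs], of which [s] lists those that may remain
between [u] and [v].  When none remains, [f] has a constant strict sign on the
open interval, against continuity at its ends. *)
Lemma cell_signs_ivt d (a : d.-tuple K) rs (u v : K) : size rs = d -> cell_signs a rs ->
  u < v -> mpeval a u * mpeval a v < 0 -> exists2 c, u < c < v & mpeval a c = 0.
Proof.
move=> srs sg.
suff H (s : seq K) : {in rs, forall r, u < r < v -> r \in s} -> u < v ->
    mpeval a u * mpeval a v < 0 -> exists2 c, u < c < v & mpeval a c = 0.
  exact: (H rs (fun r hr _ => hr)).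
elim: s u v => [|r s IH] u v rs_s uv fuv; last first.
  have [/andP[ur rv]|nr] := boolP (u < r < v); last first.
    apply: IH => // x /rs_s h uxv; have := h uxv; rewrite inE.
    by case/predU1P => // xr; move: nr; rewrite -xr uxv.
  have in_s x : x \in rs -> u < x < v -> x != r -> x \in s.
    by move=> xrs uxv xr; have := rs_s x xrs uxv; rewrite inE (negbTE xr).
  have [fr|fr] := eqVneq (mpeval a r) 0; first by exists r; rewrite ?ur.
  have [fur|fur] := ltrP (mpeval a u * mpeval a r) 0.
    have [|||c /andP[uc cr] fc] := IH u r => //.
      move=> x xrs /andP[ux xr]; apply: in_s => //; last by rewrite lt_eqF.
      by rewrite ux (lt_trans xr).
    by exists c; rewrite ?uc ?(lt_trans cr).
  have [|||c /andP[rc cv] fc] := IH r v => //.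
  - move=> x xrs /andP[rx xv]; apply: in_s => //; last by rewrite gt_eqF.
    by rewrite xv (lt_trans ur).
  - have fu : mpeval a u != 0 by apply: contraTneq fuv => ->; rewrite mul0r ltxx.
    have {}fur : 0 < mpeval a u * mpeval a r by rewrite lt_neqAle eq_sym mulf_neq0.
    have : (mpeval a u * mpeval a r) * (mpeval a r * mpeval a v) < 0.
      have -> : (mpeval a u * mpeval a r) * (mpeval a r * mpeval a v) =
        mpeval a r ^+ 2 * (mpeval a u * mpeval a v) by ring.
      by rewrite pmulr_rlt0 // exprn_even_gt0 // orbT.
    by rewrite pmulr_rlt0.
  by exists c; rewrite ?cv ?(lt_trans ur).
have same z z' : u < z < v -> u < z' < v -> 0 < mpeval a z * mpeval a z'.
  move=> hz hz'.
  have out x : u < x < v -> x \notin rs.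
    by move=> hx; apply/negP => /rs_s/(_ hx).
  have kE : find (fun r => z <= r) rs = find (fun r => z' <= r) rs.
    apply: eq_in_find => r rrs; have : ~~ (u < r < v).
      by apply/negP => /(rs_s r rrs).
    rewrite negb_and -!leNgt; case/andP: hz => uz zv; case/andP: hz' => uz' z'v.
    case/orP=> h; last by rewrite !(ltW (lt_le_trans _ h)).
    by rewrite !(lt_geF (le_lt_trans h _)).
  have cz' := cell_find (out z' hz'); have cz := cell_find (out z hz).
  rewrite kE in cz; set k := find _ rs in cz cz'.
  have kd : (k <= d)%N by rewrite -srs find_size.
  have sz := sg k z kd cz; have sz' := sg k z' kd cz'.
  by have := mulr_gt0 sz sz'; rewrite mulrACA -expr2 sqrr_sign mul1r.
have [|z hz fz] := @poly_lt0_right _ (- mpeval a u *: mpoly_of a) u v uv.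
  rewrite hornerZ horner_mpoly_of mulNr oppr_lt0 -expr2 exprn_even_gt0 //=.
  by apply: contraTneq fuv => ->; rewrite mul0r ltxx.
have [|z' hz' fz'] := @poly_lt0_left _ (- mpeval a v *: mpoly_of a) u v uv.
  rewrite hornerZ horner_mpoly_of mulNr oppr_lt0 -expr2 exprn_even_gt0 //=.
  by apply: contraTneq fuv => ->; rewrite mulr0 ltxx.
move: fz fz'; rewrite !hornerZ !horner_mpoly_of !mulNr !oppr_lt0 => fz fz'.
have := mulr_gt0 fz fz'; rewrite mulrACA.
by rewrite ltNge mulr_le0_ge0 // ltW // same.
Qed.

End VirtualRootsField.

(** * Virtual roots over a real closed field *)

Section RealClosed.
Variable R : rcfType.
Local Notation pos := (fun u : R => 0 <= u).

Lemma ivt_rcf n : ivt_upto R n.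
Proof.
move=> p _ a b ab pab; have [c] := poly_ivtoo (ltW ab) pab.
by rewrite in_itv; exists c.
Qed.

(** Consecutive virtual roots are separated by a virtual root of the derivative. *)
Lemma vroots_sorted d (a : d.-tuple R) rs j u v : vroots pos a rs ->
  lo_bound rs j = Some u -> onth rs j = Some v -> u <= v.
Proof.
case: d a => [|n] a /=; first by move->; case: j => //= j; rewrite onth0n.
case=> srs [b [ss [ab hb h]]]; case: j => // j uE vE.
have jn : (j.+1 < size rs)%N by rewrite -onthTE vE.
move: uE; rewrite /lo_bound (onth_ltn 0 (ltnW jn)) => -[<-].
have [->] : Some v = Some (nth 0 rs j.+1) by rewrite -vE; exact: onth_ltn.
have hj : (j < size ss)%N by rewrite (size_vroots hb) -ltnS -srs.
have := h j; have := h j.+1.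
rewrite -srs /vroot_conds /= (onth_ltn 0 hj) => /(_ jn) h2 /(_ (ltnW jn)) h1.
exact: le_trans (vroot_le_hi h1) (vroot_lo_le h2).
Qed.

Lemma monic_gt0 (p : {poly R}) m : p \is monic -> exists2 v, m < v & 0 < p.[v].
Proof.
move=> /monicP pm; have [|n hn] := @poly_pinfty_gt_lc R p; first by rewrite pm ltr01.
exists (Num.max n (m + 1)); first by rewrite lt_max ltrDl ltr01 orbT.
by apply: lt_le_trans (hn _ _); rewrite ?pm ?ltr01 // le_max lexx.
Qed.

Lemma monic_ninfty (p : {poly R}) m : p \is monic ->
  exists2 v, v < m & 0 < (-1) ^+ (size p).-1 * p.[v].
Proof.
move=> pm; have [|v vm pv] := @monic_gt0 ((-1) ^+ (size p).-1 *: (p \Po - 'X)) (- m).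
  rewrite monicE lead_coefZ lead_coef_comp ?size_polyN ?size_polyX //.
  by rewrite (monicP pm) lead_coefN lead_coefX mul1r -expr2 sqrr_sign.
exists (- v); first by rewrite ltrNl.
by move: pv; rewrite hornerZ horner_comp !hornerE.
Qed.

(** On its cell, [s * f] is increasing.  If it is nonpositive at the upper end,
this end is a solution; if it is nonnegative at the lower end, that end is;
otherwise [f] has a root inside, which is one.  Infinite ends are replaced by
points where [f] has the sign of its leading term. *)
Lemma vroot_exists n (a : n.+1.-tuple R) b ss j : is_mpderiv a b ->
  vroots pos b ss -> (j <= n)%N ->
  exists2 x, all_pos pos (vroot_conds a ss j x) & x \in ss \/ mpeval a x = 0.
Proof.
move=> ab hb jn; rewrite /vroot_conds.
have sss := size_vroots hb.
have sg : cell_signs b ss by apply: vroots_cell_signs hb; apply: ivt_rcf.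
set s := (-1) ^+ (n - j).
have mono u v : le_cell (lo_bound ss j) (onth ss j) u v -> u < v ->
    s * mpeval a u < s * mpeval a v.
  move=> cl uv; exact (mpeval_incr ab sg (@ivt_rcf _) jn cl uv).
(* At an infinite end, the bounds against the other end or 0 ensure u <= v. *)
have lo_lt : exists2 u, if lo_bound ss j is Some w then u = w else
     s * mpeval a u < 0 /\ if onth ss j is Some w then u < w else u < 0
   & u \in ss \/ lo_bound ss j = None.
  case: j jn @s mono => [|j] jn s mono; rewrite /lo_bound.
    pose m := if onth ss 0 is Some w then w else 0.
    have [u um fu] := monic_ninfty m (monic_mpoly_of a).
    exists u; last by right.
    split; last by move: um; rewrite /m; case: (onth ss 0).
    move: fu; rewrite size_mpoly_of horner_mpoly_of /= exprS mulN1r mulNr.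
    by rewrite oppr_gt0 /s subn0.
  have js : (j < size ss)%N by rewrite sss.
  by rewrite (onth_ltn 0 js); exists (nth 0 ss j) => //; left; rewrite mem_nth.
have hi_gt : exists2 v, if onth ss j is Some w then v = w else
     0 < s * mpeval a v /\ if lo_bound ss j is Some w then w < v else 0 < v
   & v \in ss \/ onth ss j = None.
  have [js|js] := ltnP j (size ss).
    by rewrite (onth_ltn 0 js); exists (nth 0 ss j) => //; left; rewrite mem_nth.
  rewrite onth_default //.
  pose m := if lo_bound ss j is Some w then w else 0.
  have [v vm fv] := monic_gt0 m (monic_mpoly_of a).
  exists v; last by right.
  have jE : j = n by apply/eqP; rewrite eqn_leq jn -sss.
  split; last by move: vm; rewrite /m; case: (lo_bound ss j).
  by rewrite /s jE subnn mul1r -horner_mpoly_of.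
case: lo_lt hi_gt => u hu uss [v hv vss].
have uv : u <= v.
  case E: (lo_bound ss j) hu hv => [w|] /=; case F: (onth ss j) => [w'|] /=.
  - by move=> -> ->; apply: vroots_sorted hb E F.
  - by move=> -> [_ /ltW].
  - by move=> [_ +] ->; apply: ltW.
  by move=> [_ u0] [_ v0]; apply: ltW (lt_trans u0 v0).
have cl : le_cell (lo_bound ss j) (onth ss j) u v.
  by apply/andP; split; [case: (lo_bound _ _) hu => // w ->|case: (onth _ _) hv => // w ->].
have fuv : s * mpeval a u <= s * mpeval a v.
  by move: uv; rewrite le_eqVlt => /predU1P[->//|/(mono _ _ cl)/ltW].
have [fv|fv] := lerP (s * mpeval a v) 0.
  have fu := le_trans fuv fv.
  have hiE : onth ss j = Some v.
    by case: (onth ss j) hv => [w ->//|[]]; rewrite ltNge fv.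
  exists v; last by case: vss; [left|rewrite hiE].
  rewrite hiE; apply/all_pos_cat; split; last first.
    by apply/all_pos3; rewrite subrr mulr0 mul0r.
  case: (lo_bound ss j) hu => [w <-|_].
    apply/all_pos3; split; rewrite ?subr_ge0 //.
      by rewrite oppr_ge0 mulrAC mulr_le0_ge0 // subr_ge0.
    by rewrite oppr_ge0 mulrAC mulr_le0_ge0 // subr_ge0.
  by apply/all_pos1; rewrite oppr_ge0.
have [fu|fu] := lerP 0 (s * mpeval a u).
  have loE : lo_bound ss j = Some u.
    by case: (lo_bound ss j) hu => [w ->//|[]]; rewrite ltNge fu.
  exists u; last by case: uss; [left|rewrite loE].
  rewrite loE; apply/all_pos_cat; split.
    by apply/all_pos3; rewrite subrr mulr0 mul0r oppr0.
  case: (onth ss j) hv => [w <-|_].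
    apply/all_pos3; split; rewrite ?subr_ge0 //.
      by rewrite mulrAC mulr_ge0 ?subr_ge0 // ltW.
    by rewrite mulrAC mulr_ge0 ?subr_ge0.
  exact/all_pos1.
have [|x] := @poly_ivtoo _ (s *: mpoly_of a) u v uv.
  by rewrite !hornerZ !horner_mpoly_of nmulr_rlt0.
rewrite in_itv /= => /andP[ux xv].
rewrite rootE hornerZ horner_mpoly_of => /eqP fx.
exists x; last first.
  right; move/eqP: fx; rewrite mulf_eq0 => /orP[|/eqP//].
  by rewrite /s signr_eq0.
apply/all_pos_cat; split.
  case: (lo_bound ss j) hu => [w <-|_].
    apply/all_pos3; split.
    - by rewrite subr_ge0 ltW.
    - by rewrite oppr_ge0 mulrAC mulr_le0_ge0 // ltW // subr_gt0.
    - by rewrite mulrAC fx mul0r oppr0.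
  by apply/all_pos1; rewrite fx oppr0.
case: (onth ss j) hv => [w <-|_].
  apply/all_pos3; split.
  - by rewrite subr_ge0 ltW.
  - by rewrite mulrAC mulr_ge0 // ltW // subr_gt0.
  - by rewrite mulrAC fx mul0r.
by apply/all_pos1; rewrite fx.
Qed.

End RealClosed.

Local Open Scope classical_set_scope.

(** * Prime ideals and f-rings *)

Section Krull.
Variable A : comPzRingType.
Implicit Types (I S P : set A).

Record is_ideal I : Prop := IsIdeal {
  ideal0 : I 0;
  idealD : forall x y, I x -> I y -> I (x + y);
  idealM : forall a x, I x -> I (a * x)
}.

Lemma ideal_adjoin I x : is_ideal I ->
  is_ideal [set z | exists i a, I i /\ z = i + a * x].
Proof.
move=> hI; split.
- by exists 0, 0; split; [exact: ideal0|rewrite mul0r addr0].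
- move=> _ _ [i [a [hi ->]]] [j [b [hj ->]]].
  by exists (i + j), (a + b); split; [exact: idealD|ring].
move=> c _ [i [a [hi ->]]].
by exists (c * i), (c * a); split; [exact: idealM|ring].
Qed.

(** Krull: an ideal maximal among those disjoint from [S] is prime. *)
Lemma prime_avoiding I S : is_ideal I -> S 1 ->
  (forall x y, S x -> S y -> S (x * y)) -> (forall x, I x -> ~ S x) ->
  exists P, [/\ prime_ideal P, I `<=` P & forall x, S x -> ~ P x].
Proof.
move=> hI S1 SM IS.
pose good J := [/\ is_ideal J, I `<=` J & forall x, J x -> ~ S x].
(* [set0] is admitted because the union of the empty chain is empty. *)
have [F Ftot|M [hM Mmax]] := @Zorn_bigcup A [set J | J = set0 \/ good J].
  move=> tot; have [[J FJ]|none] := pselect (exists2 J, F J & J !=set0); last first.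
    left; rewrite -subset0 => x [J FJ Jx].
    by apply: none; exists J => //; exists x.
  move=> J0.
  have gd X x : F X -> X x -> good X.
    by move=> FX Xx; case: (Ftot X FX) => // X0; rewrite X0 in Xx.
  case: J0 => x0 Jx0; have [hJ IJ JS] := gd J x0 FJ Jx0.
  right; split; first split.
  - by exists J => //; exact: ideal0.
  - move=> x y [X FX Xx] [Y FY Yy].
    have [hX _ _] := gd X x FX Xx; have [hY _ _] := gd Y y FY Yy.
    have [XY|YX] := tot X Y FX FY.
      by exists Y => //; apply: idealD => //; exact: XY.
    by exists X => //; apply: idealD => //; exact: YX.
  - move=> a x [X FX Xx]; have [hX _ _] := gd X x FX Xx.
    by exists X => //; exact: idealM.
  - by move=> x Ix; exists J => //; exact: IJ.
  by move=> x [X FX Xx]; have [_ _] := gd X x FX Xx; apply.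
have gI : good I by split.
have {hM} [hM IM MS] : good M.
  case: hM => // M0; exfalso; apply: (Mmax I); last by right.
  by rewrite M0; split=> [x //|h]; exact: (h 0 (ideal0 hI)).
have meet x : ~ M x -> exists m a, M m /\ S (m + a * x).
  move=> Mx; apply: contrapT => none.
  apply: (Mmax [set z | exists i a, M i /\ z = i + a * x]).
    split; first by move=> m Mm; exists m, 0; rewrite mul0r addr0.
    move=> h; apply: Mx; apply: h; exists 0, 1.
    by split; [exact: ideal0|rewrite add0r mul1r].
  right; split; first exact: ideal_adjoin.
    by move=> i Ii; exists i, 0; rewrite mul0r addr0; split => //; exact: IM.
  by move=> _ [m [a [Mm ->]]] Sz; apply: none; exists m, a.
exists M; split=> //; last by move=> x Sx Mx; exact: (MS x).
split; [exact: ideal0|exact: idealD|exact: idealM|by move=> /MS|].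
move=> x y Mxy; apply: contrapT => /not_orP[/meet[m [a [Mm Sm]]] /meet[k [b [Mk Sk]]]].
apply: (MS _ _ (SM _ _ Sm Sk)).
have -> : (m + a * x) * (k + b * y) = (k + b * y) * m + (a * x) * k + (a * b) * (x * y).
  by ring.
by do 2?[apply: idealD => //]; exact: idealM.
Qed.

Lemma prime_idealX P x n : prime_ideal P -> P (x ^+ n) -> P x.
Proof.
move=> hP; elim: n => [|n IH]; first by rewrite expr0 => /(prime_ideal1 hP).
by rewrite exprS => /(prime_ideal_prime hP)[].
Qed.

Lemma prime_convex (le : A -> A -> Prop) P a b :
  (forall x y, le 0 x -> le x y -> exists z, z * y = x ^+ 2) ->
  prime_ideal P -> le 0 a -> le a b -> P b -> P a.
Proof.
move=> cvx hP a0 ab Pb; have [z zE] := cvx a b a0 ab.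
by apply: (@prime_idealX P a 2) => //; rewrite -zE; exact: (prime_idealM hP).
Qed.

(** Closure under square roots suffices, since [x ^+ n] divides [x ^+ (2 ^ n)]. *)
Lemma sqr_closed_radical I x n : is_ideal I ->
  (forall y, I (y ^+ 2) -> I y) -> I (x ^+ n) -> I x.
Proof.
move=> hI sqI Ixn; have : I (x ^+ (2 ^ n)).
  rewrite -(subnK (ltnW (ltn_expl n (ltnSn 1)))) exprD.
  exact: (idealM hI).
elim: n {Ixn} => [|n IH]; first by rewrite expr1.
by rewrite expnS mulnC exprM => /sqI/IH.
Qed.

Lemma primes_radical I x : is_ideal I ->
  (forall P, prime_ideal P -> I `<=` P -> P x) -> exists n, I (x ^+ n).
Proof.
move=> hI h; apply: contrapT => none.
have [||||P [hP IP Px]] := @prime_avoiding I [set y | exists n, y = x ^+ n] => //.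
- by exists 0%N; rewrite expr0.
- by move=> _ _ [m ->] [n ->]; exists (m + n)%N; rewrite exprD.
- by move=> y Iy [n yE]; apply: none; exists n; rewrite -yE.
by apply: (Px x); [exists 1%N; rewrite expr1|exact: h].
Qed.

Lemma zero_is_ideal : is_ideal [set (0 : A)].
Proof. by split=> [//|x y -> ->|a x ->]; rewrite ?addr0 ?mulr0. Qed.

Lemma reduced_primes0 x : reduced A ->
  (forall P, prime_ideal P -> P x) -> x = 0.
Proof.
move=> red h; have [|n /red] := @primes_radical [set 0] x zero_is_ideal => //.
by move=> P hP _; exact: h.
Qed.

End Krull.

Section FRingTheory.
Variables (A : comPzRingType) (v : A -> A -> A).
Hypothesis fr : is_fring v.
Local Notation le := (fle v).

Definition ppart (x : A) : A := v x 0.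
Definition npart (x : A) : A := v (- x) 0.

Let veexx := fring_veexx fr.
Let veeC := fring_veeC fr.
Let veeA := fring_veeA fr.
Let addDr := fring_addDr fr.
Let addDl x y z : v x y + z = v (x + z) (y + z).
Proof. by rewrite addrC addDr ![z + _]addrC. Qed.

Lemma fle_refl x : le x x. Proof. exact: veexx. Qed.

Lemma fle_anti x y : le x y -> le y x -> x = y.
Proof. by rewrite /fle veeC => -> . Qed.

Lemma fle_trans y x z : le x y -> le y z -> le x z.
Proof. by rewrite /fle => xy yz; rewrite -yz veeA xy. Qed.

Lemma fle_veel x y : le x (v x y).
Proof. by rewrite /fle [v x y]veeC veeA veexx. Qed.

Lemma fle_veer x y : le y (v x y).
Proof. by rewrite veeC; exact: fle_veel. Qed.

Lemma fle_vee x y z : le x z -> le y z -> le (v x y) z.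
Proof. by rewrite /fle => xz yz; rewrite -veeA xz yz. Qed.

Lemma fle_subr x y : le x y <-> le 0 (y - x).
Proof.
rewrite /fle; split=> h; first by rewrite -{1}(subrr x) -addDl h.
by rewrite -{2}(subrK x y) -h addDl subrK add0r.
Qed.

Lemma fle_oppr x : le 0 (- x) <-> le x 0.
Proof. by rewrite (fle_subr x 0) sub0r. Qed.

Lemma fle_opp x y : le x y <-> le (- y) (- x).
Proof. by rewrite (fle_subr x) (fle_subr (- y)) opprK addrC. Qed.

Lemma fle_addr0 x y : le 0 x -> le 0 y -> le 0 (x + y).
Proof. exact: fring_addr_ge0. Qed.

Lemma fle_mulr0 x y : le 0 x -> le 0 y -> le 0 (x * y).
Proof. exact: fring_mulr_ge0. Qed.

Lemma ppart_ge0 x : le 0 (ppart x). Proof. exact: fle_veer. Qed.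
Lemma npart_ge0 x : le 0 (npart x). Proof. exact: fle_veer. Qed.

Lemma part_sub x : ppart x - npart x = x.
Proof. by apply/eqP; rewrite subr_eq /npart addDr subrr addr0 veeC. Qed.

(** With [p] and [m] the two parts, [p + m] is their supremum, so [(p + m)^2] is
the supremum of [p^2] and [m^2], plus [p m].  This is at most
[p^2 + m^2 + p m], whence [p m <= 0]. *)
Lemma ppart_mul_npart x : ppart x * npart x = 0.
Proof.
set p := ppart x; set m := npart x.
have p0 : le 0 p := ppart_ge0 x; have m0 : le 0 m := npart_ge0 x.
have pE : p = x + m by rewrite -[x in RHS]part_sub subrK.
have pm : v p m = p + m by rewrite {1}pE -{2}(add0r m) -addDl.
have pm0 := fle_mulr0 p0 m0.
set c := p * m in pm0 *.
have pm0' : le 0 (p + m) by exact: fle_addr0.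
have sq : (p + m) * (p + m) = v (p * p) (m * m) + c.
  rewrite -{2}pm (fring_mulr_vee fr) // addDl.
  by congr v; rewrite /c; ring.
have lesum : le (v (p * p) (m * m)) (p * p + m * m).
  by apply: fle_vee; apply/fle_subr; rewrite ?addrK ?[_ + m * m]addrC ?addrK;
    exact: fle_mulr0.
apply: (fle_anti _ pm0); apply/(fle_subr c 0); rewrite sub0r.
have -> : - c = p * p + m * m - v (p * p) (m * m).
  by rewrite -[v _ _](addrK c) -sq /c; ring.
exact: (fle_subr _ _).1 lesum.
Qed.

Lemma fle_sqr x : le 0 (x ^+ 2).
Proof.
have -> : x ^+ 2 = ppart x * ppart x + npart x * npart x - (ppart x * npart x) *+ 2.
  by rewrite -{1}[x]part_sub; ring.
rewrite ppart_mul_npart mul0rn subr0.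
have p0 := ppart_ge0 x; have m0 := npart_ge0 x.
by apply: fle_addr0; exact: fle_mulr0.
Qed.

Lemma npart_eq0 x : npart x = 0 <-> le 0 x.
Proof.
rewrite -[x in le 0 x]part_sub; split=> [->|]; first by rewrite subr0; exact: ppart_ge0.
by rewrite part_sub => /fle_opp; rewrite oppr0 /npart /fle veeC.
Qed.

Lemma fabs_id x : le 0 x -> fabs v x = x.
Proof.
move=> x0; apply: (@fle_trans 0 (- x)) => //.
by move/fle_opp: x0; rewrite oppr0.
Qed.

Lemma fmeet_l x y : le x y -> fmeet v x y = x.
Proof. by move=> /fle_opp h; rewrite /fmeet h opprK. Qed.

Lemma fmeet_lel x y : le (fmeet v x y) x.
Proof. by apply/fle_opp; rewrite opprK; exact: fle_veel. Qed.

Lemma fmeet_ler x y : le (fmeet v x y) y.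
Proof. by apply/fle_opp; rewrite opprK; exact: fle_veer. Qed.

Lemma fle_fmeet x y z : le z x -> le z y -> le z (fmeet v x y).
Proof. by move=> zx zy; apply/fle_opp; rewrite opprK; apply: fle_vee; exact: (fle_opp _ _).1. Qed.

End FRingTheory.

(** * Fields ordered by their squares *)

Section SqOrder.
Variable F : fieldType.
Hypothesis sqD : forall x y : F, exists z, x ^+ 2 + y ^+ 2 = z ^+ 2.
Hypothesis sq_total : forall x : F, exists y, x = y ^+ 2 \/ - x = y ^+ 2.
Hypothesis sqD_eq0 : forall x y : F, x ^+ 2 + y ^+ 2 = 0 -> x = 0.

Definition is_sq (x : F) : bool := `[< exists y, x = y ^+ 2 >].
Definition sq_le (x y : F) : bool := is_sq (y - x).
Definition sq_norm (x : F) : F := if is_sq x then x else - x.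

Fact sq_le0_add x y : sq_le 0 x -> sq_le 0 y -> sq_le 0 (x + y).
Proof.
rewrite /sq_le !subr0 => /asboolP[u ->] /asboolP[w ->]; apply/asboolP; exact: sqD.
Qed.

Fact sq_le0_mul x y : sq_le 0 x -> sq_le 0 y -> sq_le 0 (x * y).
Proof.
rewrite /sq_le !subr0 => /asboolP[u ->] /asboolP[w ->]; apply/asboolP.
by exists (u * w); rewrite exprMn.
Qed.

Fact is_sq_anti x : is_sq x -> is_sq (- x) -> x = 0.
Proof.
move=> /asboolP[u ->] /asboolP[w wE].
by rewrite (@sqD_eq0 u w) ?expr0n // -wE addrN.
Qed.

Fact sq_le0_anti x : sq_le 0 x -> sq_le x 0 -> x = 0.
Proof. by rewrite /sq_le subr0 sub0r; exact: is_sq_anti. Qed.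

Fact sq_sub_ge0 x y : sq_le 0 (y - x) = sq_le x y.
Proof. by rewrite /sq_le subr0. Qed.

Fact is_sq_total x : is_sq x || is_sq (- x).
Proof.
have [y [xE|xE]] := sq_total x; apply/orP; [left|right]; apply/asboolP; exact: ex_intro xE.
Qed.

Fact sq_le0_total x : sq_le 0 x || sq_le x 0.
Proof. by rewrite /sq_le subr0 sub0r is_sq_total. Qed.

Fact sq_normN x : sq_norm (- x) = sq_norm x.
Proof.
rewrite /sq_norm opprK; have := is_sq_total x.
case: (boolP (is_sq x)) => [xs|] /=; last by move=> _ ->.
by case: ifP => // nxs; rewrite (is_sq_anti xs nxs) oppr0.
Qed.

Fact sq_ge0_norm x : sq_le 0 x -> sq_norm x = x.
Proof. by rewrite /sq_le subr0 /sq_norm => ->. Qed.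

Definition sq_real_field : realFieldType :=
  HB.pack (GRing.Field.sort F)
    (Num.IntegralDomain_isLeReal.Build F sq_le0_add sq_le0_mul sq_le0_anti
      sq_sub_ge0 sq_le0_total sq_normN sq_ge0_norm (fun x y => erefl)).

Lemma square_ordered_field : exists (R : realFieldType) (f : {rmorphism F -> R}),
  bijective f /\ forall x, 0 <= f x <-> exists y, x = y ^+ 2.
Proof.
exists sq_real_field, (idfun : {rmorphism F -> F}); split; first by exists idfun.
by move=> x; rewrite -[_ <= _]/(sq_le 0 x) /sq_le subr0; split=> /asboolP.
Qed.
End SqOrder.

Lemma rcf_of_ivt (R : realFieldType) : 
  (forall (p : {poly R}) a b, a <= b -> p.[a] <= 0 <= p.[b] -> exists2 x, a <= x <= b & root p x) ->
  exists (R' : rcfType) (f : {rmorphism R -> R'}), bijective f.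
Proof.
move=> h.
pose R' : rcfType := HB.pack (Num.RealField.sort R) (Num.RealField_isClosed.Build R h).
exists R', (idfun : {rmorphism R -> R}). by exists idfun.
Qed.

Lemma frac_ratio (D : idomainType) (z : {fraction D}) :
  exists x y : D, y != 0 /\ z * FracField.tofrac y = FracField.tofrac x.
Proof.
elim/quotW: z => f; exists (frac f).1, (frac f).2; split; first exact: denom_ratioP.
unlock FracField.tofrac.
rewrite -[_ * _]/(FracField.mul _ _).
rewrite -FracField.pi_mul.
apply/eqmodP => /=; rewrite /FracField.mulf /FracField.equivf /= !numden_Ratio ?mulf_neq0 ?oner_neq0 ?denom_ratioP //.
by rewrite !mulr1 mulrC.
Qed.

(** * Virtual roots in a model of Arc *)

Section Place.
Variables (A : comPzRingType) (P : set A) (hP : prime_ideal P).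

Definition place : {rmorphism A -> residue_field hP} :=
  (@FracField.tofrac (residue_domain hP) : {rmorphism _ -> _}) \o residue hP.

Lemma place_eq0 a : place a = 0 <-> P a.
Proof.
rewrite -(residue_eq0 hP) /=; split=> [/eqP|->]; last by rewrite tofrac0.
by rewrite tofrac_eq0 => /eqP.
Qed.

Lemma place_neq0 a : ~ P a -> place a != 0.
Proof. by move=> Pa; apply/eqP => /place_eq0. Qed.

Lemma place_ratio z : exists a b, ~ P b /\ z * place b = place a.
Proof.
have [x [y [y0 zE]]] := @frac_ratio (residue_domain hP) z.
have [a aE] := residue_surj x; have [b bE] := residue_surj y.
exists a, b; split; last by rewrite /= aE bE.
by move=> /(residue_eq0 hP); rewrite bE; apply/eqP.
Qed.
End Place.

Section TupleOfPoly.
Variable R : comNzRingType.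

Lemma mpeval_monic d (p : {poly R}) (a : d.-tuple R) z : p \is monic ->
  size p = d.+1 -> (forall i : 'I_d, tnth a i = - p`_(d.-1 - i)) ->
  mpeval a z = p.[z].
Proof.
move=> /monicP pm sp aE; rewrite horner_coef sp big_ord_recr /=.
rewrite -[p`_d]/(p`_(d.+1.-1)) -sp -[_`_(size p).-1]/(lead_coef p) pm mul1r /mpeval.
rewrite addrC; congr (_ + _); rewrite -sumrN (reindex_inj rev_ord_inj) /=.
apply: eq_bigr => i _; rewrite aE mulNr opprK.
have -> // : (d.-1 - (d - i.+1) = i)%N.
by case: d i {sp aE a} => [[]//|d] i; rewrite subSS subKn // -ltnS.
Qed.

(** Substitution of [X/c] for [X], normalized to be monic; it clears denominators. *)
Lemma mpeval_scale d (a b : d.-tuple R) c z :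
  (forall i : 'I_d, tnth b i = c ^+ i.+1 * tnth a i) ->
  mpeval b (c * z) = c ^+ d * mpeval a z.
Proof.
move=> bE; rewrite /mpeval mulrBr exprMn mulr_sumr; congr (_ - _).
apply: eq_bigr => i _; rewrite bE exprMn.
have -> : c ^+ d = c ^+ i.+1 * c ^+ (d.-1 - i).
  rewrite -exprD; congr (_ ^+ _).
  by case: d i {a b bE} => [[]//|d] i; rewrite addSn subnKC // -ltnS.
by ring.
Qed.
End TupleOfPoly.

Lemma is_mpderiv_mpderiv (A : comPzRingType) (S : arc_ops A) n
  (a : n.+2.-tuple A) : is_fring (vee S) -> fractions_axiom S ->
  is_mpderiv a (mpderiv S a).
Proof.
move=> fr frac i; rewrite tnth_mktuple mulrA [_ * Fr _ _ _]mulrC.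
by rewrite Fr1nat // mul1r.
Qed.

Section ArcModel.
Variables (A : comPzRingType) (S : arc_ops A).
Hypothesis hS : is_arc_model S.
Let fr : is_fring (vee S) := arc_fring hS.
Local Notation le := (fle (vee S)).

(** [x] and [-x], as well as [0] and [0], are the roots of [X^2]. *)
Lemma arc_sqr0 (x : A) : x ^+ 2 = 0 -> x = 0.
Proof.
rewrite expr2 => xx; have := arc_vrsup hS x (- x).
have -> : [tuple x + - x; - (x * - x)] = [tuple 0 + 0; - (0 * 0)].
  by apply: val_inj => /=; rewrite subrr mulrN xx mul0r addr0 !oppr0.
rewrite (arc_vrsup hS) (fring_veexx fr) => h.
have x0 : le x 0 by rewrite h; exact: fle_veel.
have nx0 : le (- x) 0 by rewrite h; exact: fle_veer.
by apply: (fle_anti fr) => //; rewrite -(opprK x); apply/(fle_oppr fr).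
Qed.

Lemma arc_reduced : reduced A.
Proof.
by move=> x n; apply: (sqr_closed_radical (zero_is_ideal A)) => y; exact: arc_sqr0.
Qed.

Lemma arc_vroots d (a : d.-tuple A) :
  vroots (le 0) a [seq rho S i a | i <- enum 'I_d].
Proof.
elim: d a => [|n IH] a /=.
  by rewrite -[RHS]/(map (fun i => rho S i a) [::]); congr map; apply: size0nil; rewrite size_enum_ord.
split; first by rewrite size_map size_enum_ord.
have nthE m (b : m.-tuple A) (i : 'I_m) : nth 0 [seq rho S k b | k <- enum 'I_m] i = rho S i b.
  by rewrite (nth_map i) ?size_enum_ord // nth_ord_enum.
have onthE m (b : m.-tuple A) (i : 'I_m) : onth [seq rho S k b | k <- enum 'I_m] i = Some (rho S i b).
  by rewrite (onth_ltn 0) ?nthE // size_map size_enum_ord.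
have onthN m (b : m.-tuple A) : onth [seq rho S k b | k <- enum 'I_m] m = None.
  by apply: onth_default; rewrite size_map size_enum_ord.
case: n a IH => [|n] a IH.
  exists [tuple], [::]; split=> // [[] //|] j; rewrite ltnS leqn0 => /eqP->.
  have [x ->] : exists x, a = [tuple x].
    by exists (tnth a ord0); apply: eq_from_tnth => i; rewrite ord1.
  rewrite -[0%N]/(nat_of_ord (@ord0 0)) nthE (arc_vroot1 hS).
  have f0 : mpeval [tuple x] x = 0.
    by rewrite /mpeval big_ord1 /= subnn expr0 expr1 mulr1 subrr.
  apply/all_pos_cat; rewrite f0 mulr0 oppr0.
  by split; apply/all_pos1; exact: fle_refl.
pose b := mpderiv S a.
exists b, [seq rho S i b | i <- enum 'I_n.+1]; split=> //.
  exact: is_mpderiv_mpderiv fr (arc_fractions hS).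
move=> j jn; have -> : j = Ordinal jn :> nat by [].
rewrite nthE /vroot_conds; move: (Ordinal jn) => {jn}i.
have N x : le x 0 -> le 0 (- x) by move/(fle_oppr fr).
have sub x y : le x y -> le 0 (y - x) by move/(fle_subr fr).
have [i0|i0] := posnP i.
  have -> : i = ord0 by apply: val_inj.
  have [h1 h2 h3 h4] := arc_vroot_first hS a.
  apply/all_pos_cat; split; first by apply/all_pos1/N; rewrite subn0.
  rewrite [onth _ _](onthE _ b ord0); apply/all_pos3; rewrite subn0.
  by split=> //; exact: sub.
have [im|im] := ltnP i n.+1; last first.
  have -> : i = ord_max by apply: val_inj; apply/eqP; rewrite eqn_leq im -ltnS ltn_ord.
  have [h1 h2 h3 h4] := arc_vroot_last hS a.
  rewrite [lo_bound _ _](onthE _ b ord_max) [onth _ _]onthN subnn expr0.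
  apply/all_pos_cat; rewrite !mul1r.
  by split; [apply/all_pos3; split; [exact: sub|exact: N|exact: N]|apply/all_pos1].
have [|[h1 h2] [h3 h4 h5 h6]] := arc_vroot_mid hS a (i := i); first by rewrite i0.
have hiE : onth [seq rho S i0 b | i0 <- enum 'I_n.+1] i = Some (rho S (inord i) b).
  by rewrite -[in LHS](inordK im) onthE.
have loE : lo_bound [seq rho S i0 b | i0 <- enum 'I_n.+1] i = Some (rho S (inord i.-1) b).
  case: (i : nat) i0 im => //= k _ kn.
  by rewrite -{1}(inordK (ltnW kn)) onthE.
rewrite hiE loE; apply/all_pos_cat; split; apply/all_pos3; split=> //.
- exact: sub.
- exact: N.
- exact: N.
exact: sub.
Qed.

(** The last virtual root [x] of [X^2 - a] satisfies [x >= 0], [x^2 >= a] and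
[x (x^2 - a) = 0], so [(x^2 - a)^2 = - a (x^2 - a) <= 0]. *)
Lemma arc_sqrt a : le 0 a -> exists y, a = y ^+ 2.
Proof.
move=> a0; pose p := [tuple 0; a]; exists (rho S ord_max p).
have [] := arc_vroot_last hS p.
set x := rho S ord_max p.
have -> : rho S ord_max (mpderiv S p) = 0.
  have -> : (ord_max : 'I_1) = ord0 by apply: val_inj.
  have -> : mpderiv S p = [tuple 0].
    apply: eq_from_tnth => i; rewrite tnth_mktuple !(tnth_nth 0) ord1 /=.
    by rewrite !mulr0.
  by rewrite (arc_vroot1 hS).
have -> : mpeval p x = x ^+ 2 - a.
  by rewrite /mpeval big_ord_recr big_ord1 !(tnth_nth 0) /= mul0r add0r expr0 mulr1.
rewrite subr0 => x0 _ xf f0.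
have xf0 : x * (x ^+ 2 - a) = 0.
  by apply: (fle_anti fr) => //; exact: fle_mulr0.
apply/eqP; rewrite eq_sym -subr_eq0; apply/eqP; apply: arc_sqr0.
have -> : (x ^+ 2 - a) ^+ 2 = x * (x * (x ^+ 2 - a)) - a * (x ^+ 2 - a) by ring.
rewrite xf0 mulr0 sub0r; apply: (fle_anti fr).
  by apply/(fle_oppr fr); rewrite opprK; exact: fle_mulr0.
have -> : - (a * (x ^+ 2 - a)) = (x ^+ 2 - a) ^+ 2 - x * (x * (x ^+ 2 - a)) by ring.
by rewrite xf0 mulr0 subr0; exact: fle_sqr.
Qed.

Lemma arc_convex a b : le 0 a -> le a b -> exists z, z * b = a ^+ 2.
Proof.
move=> a0 ab; exists (Fr S a b).
have [+ _ _] := arc_fractions hS a b.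
by rewrite !(fabs_id fr) ?(fmeet_l fr) //; exact: fle_trans ab.
Qed.

End ArcModel.

(** * Residue fields of a model of Arc *)

Section ArcPlace.
Variables (A : comPzRingType) (S : arc_ops A).
Hypothesis hS : is_arc_model S.
Variables (R : realFieldType) (psi : {rmorphism A -> R}).
Local Notation le := (fle (vee S)).
Hypothesis psi_ge0 : forall a, le 0 a -> 0 <= psi a.
Hypothesis psi_ratio : forall z, exists a b, psi b != 0 /\ z * psi b = psi a.

Lemma common_denominator (s : seq R) :
  exists2 c, 0 < psi c & forall x, x \in s -> exists e, psi c * x = psi e.
Proof.
elim: s => [|x s [c c0 hc]]; first by exists 1 => //; rewrite rmorph1 ltr01.
have [a [b [b0 xE]]] := psi_ratio x.
(* The square makes the new denominator positive. *)
exists (c * b ^+ 2); first by rewrite rmorphM rmorphXn mulr_gt0 // exprn_even_gt0.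
move=> y; rewrite inE => /predU1P[->|/hc [e eE]].
  by exists (c * b * a); rewrite !rmorphM -xE; ring.
by exists (b ^+ 2 * e); rewrite [RHS]rmorphM -eE rmorphM; ring.
Qed.

Lemma psi_vroots d (a : d.-tuple A) : exists rs : seq A,
  vroots (fun u : R => 0 <= u) (map_tuple psi a) (map psi rs).
Proof.
exists [seq rho S i a | i <- enum 'I_d].
exact: (vroots_map psi_ge0) (arc_vroots hS a).
Qed.

(** A polynomial of degree [d] over the field becomes, after scaling the variable
and the value, a monic polynomial over [A]; its virtual roots have the sign
property by intermediate values in smaller degrees. *)
Lemma arc_ivt n : ivt_upto R n.
Proof.
elim: n => [|d IH] p sp u w uw puw.
  by move: sp puw; rewrite leqn0 size_poly_eq0 => /eqP->; rewrite horner0 mul0r ltxx.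
move: sp; rewrite leq_eqVlt ltnS => /predU1P[sp|sp]; last exact: IH sp _ _ uw puw.
have p0 : p != 0 by rewrite -size_poly_gt0 sp.
pose l := lead_coef p; have l0 : l != 0 by rewrite lead_coef_eq0.
pose q := l^-1 *: p.
have qm : q \is monic by rewrite monicE lead_coefZ mulVf.
have sq : size q = d.+1 by rewrite size_scale ?invr_eq0.
have [c c0 hc] := common_denominator q.
have lift (i : 'I_d) : exists e, psi e = psi c ^+ i.+1 * - q`_(d.-1 - i).
  have [|e eE] := hc q`_(d.-1 - i).
    rewrite mem_nth // sq; apply: leq_ltn_trans (leq_subr _ _) _.
    by rewrite ltnS leq_pred.
  exists (- (c ^+ i * e)); rewrite rmorphN rmorphM rmorphXn -eE exprS; ring.
pose a := [tuple projT1 (cid (lift i)) | i < d].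
pose b := [tuple - q`_(d.-1 - i) | i < d].
have pE z : mpeval (map_tuple psi a) (psi c * z) = psi c ^+ d * l^-1 * p.[z].
  rewrite (@mpeval_scale _ _ b); last first.
    by move=> i; rewrite tnth_map !tnth_mktuple; case: cid.
  rewrite (@mpeval_monic _ _ q) //; last by move=> i; rewrite tnth_mktuple.
  by rewrite hornerZ mulrA.
have [rs hrs] := psi_vroots a.
have srs := size_vroots hrs.
have [|||x /andP[ux xw] fx] := @cell_signs_ivt R d (map_tuple psi a) (map psi rs)
    (psi c * u) (psi c * w) srs.
- by apply: vroots_cell_signs hrs.
- by rewrite ltr_pM2l.
- rewrite !pE mulrACA pmulr_rlt0 // -expr2 exprn_even_gt0 //=.
  by rewrite mulf_neq0 ?expf_neq0 ?invr_eq0 // gt_eqF.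
exists (x / psi c); first by rewrite ltr_pdivlMr // ltr_pdivrMr // ![_ * psi c]mulrC ux.
have : mpeval (map_tuple psi a) (psi c * (x / psi c)) = 0.
  by rewrite mulrC divfK // gt_eqF.
rewrite pE => /eqP; rewrite mulf_eq0 => /orP[|//].
by rewrite (negbTE (mulf_neq0 _ _)) ?expf_neq0 ?invr_eq0 // gt_eqF.
Qed.

Lemma arc_integral d (a : d.-tuple A) z :
  mpeval (map_tuple psi a) z = 0 -> exists x, psi x = z.
Proof.
have [rs hrs] := psi_vroots a.
move=> /(root_in_vroots (@arc_ivt d) hrs) /mapP[x _ ->]; by exists x.
Qed.

End ArcPlace.

Lemma real_closed_of_ivt (R : realFieldType) : (forall n, ivt_upto R n) ->
  exists (R' : rcfType) (f : {rmorphism R -> R'}), bijective f.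
Proof.
move=> ivt; apply: rcf_of_ivt => p a b ab /andP[pa pb].
have [pa0|pa0] := eqVneq p.[a] 0.
  by exists a; [rewrite lexx|rewrite rootE pa0].
have [pb0|pb0] := eqVneq p.[b] 0.
  by exists b; [rewrite ab lexx|rewrite rootE pb0].
have {}pa : p.[a] < 0 by rewrite lt_neqAle pa0.
have {}pb : 0 < p.[b] by rewrite lt_neqAle eq_sym pb0.
have {}ab : a < b.
  by rewrite lt_neqAle ab andbT; apply: contraTneq pa => ->; rewrite -leNgt ltW.
have [|c /andP[ac cb] rc] := ivt _ p (leqnn _) a b ab; first by rewrite pmulr_llt0.
by exists c; rewrite ?(ltW ac) ?(ltW cb).
Qed.

Section ArcResidue.
Variables (A : comPzRingType) (S : arc_ops A).
Hypothesis hS : is_arc_model S.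
Let fr : is_fring (vee S) := arc_fring hS.
Local Notation le := (fle (vee S)).
Variables (P : set A) (hP : prime_ideal P).

Lemma arc_sumsq (a b : A) : exists c, a ^+ 2 + b ^+ 2 = c ^+ 2.
Proof. by apply: (arc_sqrt hS); apply: (fle_addr0 fr); exact: fle_sqr. Qed.

Section ResidueSquares.
Variables (K : fieldType) (phi : {rmorphism A -> K}).
Hypothesis phi_eq0 : forall a, phi a = 0 <-> P a.
Hypothesis phi_ratio : forall z, exists a b, phi b != 0 /\ z * phi b = phi a.

Lemma residue_sqD (x y : K) : exists z, x ^+ 2 + y ^+ 2 = z ^+ 2.
Proof.
have [a [b [b0 xE]]] := phi_ratio x.
have [c [d [d0 yE]]] := phi_ratio y.
have [e eE] := arc_sumsq (a * d) (b * c).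
exists (phi e / (phi b * phi d)).
rewrite expr_div_n -rmorphXn -eE rmorphD !rmorphXn !rmorphM -xE -yE.
by field; rewrite b0 d0.
Qed.

(** For [x = a/b], one of the positive and negative parts of [a b] is in [P], and
the other one is a square; so [x] or [- x] is a square divided by [b^2]. *)
Lemma residue_sq_total (x : K) : exists y, x = y ^+ 2 \/ - x = y ^+ 2.
Proof.
have [a [b [b0 xE]]] := phi_ratio x.
have {}xE : x = phi (a * b) / phi b ^+ 2.
  by rewrite rmorphM -xE; field.
have [p pE] := arc_sqrt hS (ppart_ge0 fr (a * b)).
have [m mE] := arc_sqrt hS (npart_ge0 fr (a * b)).
have [|Pp|Pm] := prime_ideal_prime hP (x := ppart (vee S) (a * b)) (y := npart (vee S) (a * b)).
- by rewrite (ppart_mul_npart fr); exact: (prime_ideal0 hP).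
- exists (phi m / phi b); right.
  rewrite xE -(part_sub fr (a * b)) rmorphB ((phi_eq0 (ppart (vee S) (a * b))).2 Pp) mE rmorphXn.
  by field.
exists (phi p / phi b); left.
rewrite xE -(part_sub fr (a * b)) rmorphB ((phi_eq0 (npart (vee S) (a * b))).2 Pm).
by rewrite pE rmorphXn; field.
Qed.

Lemma residue_sqD_eq0 (x y : K) : x ^+ 2 + y ^+ 2 = 0 -> x = 0.
Proof.
have [a [b [b0 xE]]] := phi_ratio x.
have [c [d [d0 yE]]] := phi_ratio y.
move=> xy0.
have /(phi_eq0 _).1 Ps : phi ((a * d) ^+ 2 + (b * c) ^+ 2) = 0.
  rewrite rmorphD !rmorphXn !rmorphM -xE -yE.
  have -> : (x * phi b * phi d) ^+ 2 + (phi b * (y * phi d)) ^+ 2 =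
    (x ^+ 2 + y ^+ 2) * (phi b * phi d) ^+ 2 by ring.
  by rewrite xy0 mul0r.
have : P ((a * d) ^+ 2).
  apply: prime_convex (arc_convex hS) hP _ _ Ps; first exact: fle_sqr.
  by apply/(fle_subr fr); rewrite addrC addKr; exact: fle_sqr.
move=> /(prime_idealX hP) /phi_eq0 /eqP.
by rewrite rmorphM -xE !mulf_eq0 (negbTE b0) (negbTE d0) !orbF => /eqP.
Qed.

End ResidueSquares.

Local Notation K := (residue_field hP).
Local Notation phi := (place hP).

Lemma arc_residue : integrally_closed (residue_domain hP) /\ real_closed_field K.
Proof.
have phi_eq0 := place_eq0 hP.
have phi_ratio z : exists a b, phi b != 0 /\ z * phi b = phi a.
  by have [a [b [/(place_neq0 hP) b0 zE]]] := place_ratio z; exists a, b.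
have [R [f [fbij f_ge0]]] := square_ordered_field (residue_sqD phi_ratio)
  (residue_sq_total phi_eq0 phi_ratio) (residue_sqD_eq0 phi_eq0 phi_ratio).
pose psi : {rmorphism A -> R} := f \o phi.
have psi_ge0 a : le 0 a -> 0 <= psi a.
  by move=> /(arc_sqrt hS)[y ->]; apply/f_ge0; exists (phi y); rewrite rmorphXn.
have psi_ratio z : exists a b, psi b != 0 /\ z * psi b = psi a.
  case: fbij => g fK gK; have [a [b [b0 zE]]] := phi_ratio (g z).
  exists a, b; split; first by rewrite fmorph_eq0.
  by rewrite -[psi a]/(f (phi a)) -zE rmorphM gK.
have ivt n : ivt_upto R n := arc_ivt hS psi_ge0 psi_ratio (n := n).
split; last first.
  have [R' [h hbij]] := real_closed_of_ivt ivt.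
  by exists R', (h \o f : {rmorphism _ -> _}); exact: bij_comp.
move=> z [p pm pz].
pose d := (size p).-1.
have sp : size p = d.+1 by rewrite prednK // size_poly_gt0 monic_neq0.
have lift (i : 'I_d) : exists e, residue hP e = - p`_(d.-1 - i).
  exact: residue_surj.
pose a := [tuple projT1 (cid (lift i)) | i < d].
have [|x xz] := arc_integral hS psi_ge0 psi_ratio (a := a) (z := f z).
  have -> : map_tuple psi a = map_tuple f (map_tuple phi a).
    by apply: eq_from_tnth => i; rewrite !tnth_map.
  rewrite -mpeval_map (@mpeval_monic _ _ (map_poly (@FracField.tofrac _) p)).
  - by rewrite (rootP pz) rmorph0.
  - exact: monic_map.
  - rewrite size_map_inj_poly ?tofrac0 // => x y /eqP.
    by rewrite tofrac_eq => /eqP.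
  move=> i; rewrite tnth_map tnth_mktuple /=; case: cid => e /= ->.
  by rewrite coef_map rmorphN.
exists (residue hP x); exact: (bij_inj fbij).
Qed.

End ArcResidue.

Lemma arc_schwartz (A : comPzRingType) (S : arc_ops A) : is_arc_model S ->
  schwartz_real_closed A.
Proof.
move=> hS; have fr := arc_fring hS.
split; first exact: arc_reduced hS.
  exists (fle (vee S)); split.
  - split; last by exists (vee S).
    by split; [exact: fle_refl|move=> x y z; exact: fle_trans|exact: fle_anti].
  - move=> x; split; first exact: arc_sqrt.
    by case=> y ->; exact: fle_sqr.
  by move=> a b; exact: arc_convex.
by move=> P hP; exact: arc_residue hS _ hP.
Qed.

(** * From real closed rings to models of Arc *)

Section FRingSum.
Variables (A : comPzRingType) (v : A -> A -> A).
Hypothesis fr : is_fring v.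
Local Notation le := (fle v).

(** Vanishes iff all the elements of [us] are nonnegative. *)
Definition defect (us : seq A) : A := \sum_(u <- us) npart v u.

Lemma defect_ge0 us : le 0 (defect us).
Proof.
apply: (big_ind (fun x => le 0 x)); first exact: fle_refl.
  by move=> x y; exact: fle_addr0.
by move=> u _; exact: npart_ge0.
Qed.

Lemma defect_prime (P : set A) us : prime_ideal P ->
  (forall a b, le 0 a -> le a b -> P b -> P a) ->
  P (defect us) <-> all_pos (fun u => P (npart v u)) us.
Proof.
move=> hP cvx; rewrite /defect; elim: us => [|u us IH].
  by rewrite big_nil; split=> // _; exact: (prime_ideal0 hP).
rewrite big_cons; split=> [Ps w|h].
  have d0 := defect_ge0 us; have n0 := npart_ge0 fr u.
  rewrite inE => /predU1P[->|].
    by apply: cvx Ps => //; apply/(fle_subr fr); rewrite addrC addKr.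
  apply: IH.1; apply: cvx Ps => //; apply/(fle_subr fr).
  by rewrite addrK.
apply: (prime_idealD hP); first by apply: h; rewrite mem_head.
by apply/IH => w hw; apply: h; rewrite inE hw orbT.
Qed.

End FRingSum.

Section Schwartz.
Variables (A : comPzRingType) (v : A -> A -> A).
Hypothesis red : reduced A.
Hypothesis fr : is_fring v.
Local Notation le := (fle v).
Hypothesis sqP : forall x, le 0 x <-> exists y, x = y ^+ 2.
Hypothesis cvx : forall a b, le 0 a -> le a b -> exists z, z * b = a ^+ 2.
Hypothesis residues : forall (P : set A) (hP : prime_ideal P),
  integrally_closed (residue_domain hP) /\ real_closed_field (residue_field hP).

(** A real closed field over [A] with kernel [P] that contains no new integral
elements: the form in which the condition on [A/P] is used. *)
Record real_place (P : set A) (R : rcfType) (psi : {rmorphism A -> R}) : Prop :=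
  RealPlace {
    real_place_eq0 : forall a, psi a = 0 <-> P a;
    real_place_integral : forall d (a : d.-tuple A) z,
      mpeval (map_tuple psi a) z = 0 -> exists x, psi x = z }.

Lemma exists_real_place P : prime_ideal P ->
  exists (R : rcfType) (psi : {rmorphism A -> R}), real_place P psi.
Proof.
move=> hP; have [ic [R [f fbij]]] := residues hP.
exists R, (f \o place hP : {rmorphism _ -> _}); split=> [a|d a z fz].
  rewrite -(place_eq0 hP) -[X in X = 0 <-> _]/(f (place hP a)).
  by split=> [/eqP|->]; [rewrite fmorph_eq0 => /eqP|rewrite rmorph0].
case: (fbij) => g fK gK.
have [|x xE] := ic (g z).
  exists (mpoly_of (map_tuple (residue hP) a)); first exact: monic_mpoly_of.
  rewrite map_mpoly_of rootE horner_mpoly_of; apply/eqP.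
  apply: (bij_inj fbij); rewrite rmorph0 mpeval_map gK -[RHS]fz.
  by congr mpeval; apply: eq_from_tnth => i; rewrite !tnth_map.
have [b bE] := residue_surj x; exists b.
by rewrite -[LHS]/(f (place hP b)) -[RHS]gK -xE -bE.
Qed.

Section AtPlace.
Variables (P : set A) (hP : prime_ideal P) (R : rcfType) (psi : {rmorphism A -> R}).
Hypothesis hpsi : real_place P psi.

Lemma place_ge0 a : le 0 a -> 0 <= psi a.
Proof. by move=> /sqP[y ->]; rewrite rmorphXn sqr_ge0. Qed.

Lemma place_le a b : le a b -> psi a <= psi b.
Proof. by move=> /(fle_subr fr)/place_ge0; rewrite rmorphB subr_ge0. Qed.

Lemma place_ppart a : psi (ppart v a) = Num.max (psi a) 0.
Proof.
have p0 := place_ge0 (ppart_ge0 fr a); have m0 := place_ge0 (npart_ge0 fr a).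
have aE : psi a = psi (ppart v a) - psi (npart v a).
  by rewrite -rmorphB (part_sub fr).
have := ppart_mul_npart fr a => /(congr1 psi)/eqP.
rewrite rmorphM rmorph0 mulf_eq0 aE => /orP[] /eqP ->.
  by rewrite sub0r max_r // oppr_le0.
by rewrite subr0 max_l.
Qed.

Lemma place_vee a b : psi (v a b) = Num.max (psi a) (psi b).
Proof.
have -> : v a b = b + ppart v (a - b).
  by rewrite /ppart (fring_addDr fr) addrC subrK addr0.
by rewrite rmorphD place_ppart rmorphB addrC addr_maxl subrK add0r.
Qed.

Lemma place_meet a b : psi (fmeet v a b) = Num.min (psi a) (psi b).
Proof. by rewrite rmorphN place_vee !rmorphN -oppr_min opprK. Qed.

Lemma place_abs a : psi (fabs v a) = `|psi a|.
Proof.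
rewrite place_vee rmorphN; move: (psi a) => t; have [t0|t0] := lerP 0 t.
  by rewrite ger0_norm // max_l //; lra.
by rewrite ltr0_norm // max_r //; lra.
Qed.

Lemma place_npart a : 0 <= psi a <-> P (npart v a).
Proof.
rewrite -(real_place_eq0 hpsi) -[npart v a]/(ppart v (- a)) place_ppart rmorphN.
split=> [h|/max_idPr]; last by rewrite oppr_le0.
by rewrite max_r // oppr_le0.
Qed.

End AtPlace.

Lemma pointwise_le x y :
  (forall P (R : rcfType) (psi : {rmorphism A -> R}), real_place P psi ->
    psi x <= psi y) -> le x y.
Proof.
move=> h; apply/(fle_subr fr)/(npart_eq0 fr).
apply: (reduced_primes0 red) => P hP; have [R [psi hpsi]] := exists_real_place hP.
by apply/(place_npart hpsi); rewrite rmorphB subr_ge0; exact: h hpsi.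
Qed.

Lemma pointwise_eq x y :
  (forall P (R : rcfType) (psi : {rmorphism A -> R}), real_place P psi ->
    psi x = psi y) -> x = y.
Proof.
by move=> h; apply: (fle_anti fr); apply: pointwise_le => P R psi /h ->.
Qed.

(** Convexity gives an element with the required product, and clamping it between
[0] and [c] does not change this product. *)
Lemma fractions_exist : exists Fr : A -> A -> A,
  forall a b, [/\ Fr a b * fabs v b = (fmeet v (fabs v a) (fabs v b)) ^+ 2,
    le 0 (Fr a b) & le (Fr a b) (fmeet v (fabs v a) (fabs v b))].
Proof.
suff H a b : exists z, [/\ z * fabs v b = (fmeet v (fabs v a) (fabs v b)) ^+ 2,
    le 0 z & le z (fmeet v (fabs v a) (fabs v b))].
  by exists (fun a b => projT1 (cid (H a b))) => a b; case: cid.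
set c := fmeet _ _ _.
have c0 : le 0 c.
  apply: pointwise_le => P R psi h.
  by rewrite rmorph0 place_meet !place_abs le_min !normr_ge0.
have cb : le c (fabs v b) by exact: fmeet_ler.
have [z zE] := cvx c0 cb.
exists (fmeet v (ppart v z) c); split; last exact: fmeet_ler.
  apply: pointwise_eq => P R psi h; rewrite rmorphM rmorphXn place_meet place_ppart.
  have := congr1 psi zE; rewrite rmorphM rmorphXn.
  have := place_le psi cb; have := place_ge0 psi c0.
  move: (psi c) (psi z) (psi (fabs v b)) => g w t g0 gt wt.
  have [t0|t0] := ltrP 0 t; last first.
    have -> : g = 0 by lra.
    have -> : t = 0 by lra.
    by rewrite mulr0 expr0n.
  have w0 : 0 <= w by rewrite -(pmulr_lge0 _ t0) wt sqr_ge0.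
  rewrite max_l // min_l // -(ler_pM2r t0) wt expr2 ler_wpM2l //.
apply: (fle_fmeet fr) => //; exact: ppart_ge0.
Qed.

Lemma sqrt_nonneg a : le 0 a -> exists2 s, le 0 s & a = s ^+ 2.
Proof.
move=> /sqP[y ->]; exists (fabs v y); first apply: pointwise_le.
  by move=> P R psi h; rewrite rmorph0 place_abs.
apply: pointwise_eq; by move=> P R psi h; rewrite !rmorphXn place_abs real_normK ?num_real.
Qed.

Lemma defect_place P (R : rcfType) (psi : {rmorphism A -> R}) us : prime_ideal P ->
  real_place P psi ->
  P (defect v us) <-> all_pos (fun u => 0 <= u) (map psi us).
Proof.
move=> hP hpsi; rewrite (defect_prime fr _ hP); last by move=> a b; exact: prime_convex.
split=> [h _ /mapP[u hu ->]|h u hu]; first by apply/(place_npart hpsi); exact: h.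
by apply/(place_npart hpsi); apply: h; exact: map_f.
Qed.

Section Gluing.
Variable Y : A -> A.
Hypothesis Y_ex : forall P, prime_ideal P -> exists x, P (Y x).
Hypothesis Y_uniq : forall P x y, prime_ideal P -> P (Y x) -> P (Y y) -> P (x - y).
Hypothesis Y_ext : forall P x y, prime_ideal P -> P (x - y) -> P (Y x) -> P (Y y).

(** The radical of the ideal generated by [f]. *)
Definition vanishing (f : A) : set A :=
  [set a | forall P, prime_ideal P -> P f -> P a].

Lemma vanishing_ideal f : is_ideal (vanishing f).
Proof.
split=> [P hP _|x y hx hy P hP Pf|a x hx P hP Pf]; first exact: (prime_ideal0 hP).
  by apply: (prime_idealD hP); [exact: hx|exact: hy].
by apply: (prime_idealM hP); exact: hx.
Qed.

Lemma vanishing_sqr f a : vanishing f (a ^+ 2) -> vanishing f a.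
Proof. by move=> h P hP Pf; apply: (prime_idealX hP (n := 2)); exact: h. Qed.

Lemma vanishing_convex f a b : le 0 a -> le a b -> vanishing f b -> vanishing f a.
Proof. by move=> a0 ab h P hP Pf; apply: (prime_convex cvx hP a0 ab); exact: h. Qed.

Lemma vanishing_ppart f a : vanishing f a -> vanishing f (ppart v a).
Proof.
move=> h P hP Pf; have := prime_ideal_prime hP (x := ppart v a) (y := npart v a).
rewrite (ppart_mul_npart fr) => /(_ (prime_ideal0 hP))[//|Pn].
by rewrite -(subrK (npart v a) (ppart v a)) (part_sub fr); apply: (prime_idealD hP) => //; exact: h.
Qed.

Definition ideal_sum (f g : A) : set A :=
  [set a | exists i j, [/\ vanishing f i, vanishing g j & a = i + j]].

Lemma ideal_sum_ideal f g : is_ideal (ideal_sum f g).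
Proof.
have hf := vanishing_ideal f; have hg := vanishing_ideal g.
split=> [|_ _ [i [j [hi hj ->]]] [k [l [hk hl ->]]]|a _ [i [j [hi hj ->]]]].
- by exists 0, 0; rewrite addr0; split=> //; [exact: (ideal0 hf)|exact: (ideal0 hg)].
- by exists (i + k), (j + l); split; [exact: (idealD hf)|exact: (idealD hg)|ring].
by exists (a * i), (a * j); split; [exact: (idealM hf)|exact: (idealM hg)|rewrite mulrDr].
Qed.

(** Riesz decomposition: [c] is the sum of its infimum with [a] and of a remainder
between [0] and [b]. *)
Lemma ideal_sum_le f g c a b : le 0 c -> le 0 a -> le 0 b -> le c (a + b) ->
  vanishing f a -> vanishing g b -> ideal_sum f g c.
Proof.
move=> c0 a0 b0 cab fa gb; exists (fmeet v c a), (c - fmeet v c a); split.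
- exact: (vanishing_convex (fle_fmeet fr c0 a0) (fmeet_ler fr c a) fa).
- apply: vanishing_convex gb.
    exact: (fle_subr fr _ _).1 (fmeet_lel fr c a).
  apply: pointwise_le => P R psi h; rewrite rmorphB place_meet.
  have := place_le psi cab; rewrite rmorphD; have := place_ge0 psi b0.
  by rewrite minEle; case: ifP => _; lra.
by rewrite addrC subrK.
Qed.

(** If [c^2 = i + j], then [|c|] is at most the sum of the square roots of the
positive parts of [i] and [j], which lie in the two ideals since these are
radical. *)
Lemma ideal_sum_sqr f g c : ideal_sum f g (c ^+ 2) -> ideal_sum f g c.
Proof.
case=> i [j [fi gj cE]].
have [s s0 sE] := sqrt_nonneg (ppart_ge0 fr i).
have [t t0 tE] := sqrt_nonneg (ppart_ge0 fr j).
have fs : vanishing f s by apply: vanishing_sqr; rewrite -sE; exact: vanishing_ppart.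
have gt : vanishing g t by apply: vanishing_sqr; rewrite -tE; exact: vanishing_ppart.
have bound (P : set A) (R : rcfType) (psi : {rmorphism A -> R}) : real_place P psi ->
    `|psi c| <= psi s + psi t.
  move=> h; have ps := place_ge0 psi s0; have pt := place_ge0 psi t0.
  rewrite -ler_sqr ?nnegrE ?addr_ge0 // real_normK ?num_real //.
  rewrite -rmorphXn cE rmorphD.
  have : psi i <= psi s ^+ 2 by rewrite -rmorphXn -sE place_ppart le_max lexx.
  have : psi j <= psi t ^+ 2 by rewrite -rmorphXn -tE place_ppart le_max lexx.
  nra.
rewrite -(part_sub fr c); have hI := ideal_sum_ideal f g.
have npartE : npart v c = ppart v (- c) by [].
apply: (idealD hI); last rewrite -mulN1r; last apply: (idealM hI).
  apply: (ideal_sum_le (ppart_ge0 fr c) s0 t0) => //.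
  apply: pointwise_le => P R psi h; rewrite place_ppart rmorphD.
  by rewrite ge_max addr_ge0 ?place_ge0 // (le_trans (ler_norm _) (bound P R psi h)).
apply: (ideal_sum_le (npart_ge0 fr c) s0 t0) => //.
apply: pointwise_le => P R psi h; rewrite npartE place_ppart rmorphD.
rewrite ge_max addr_ge0 ?place_ge0 // andbT.
by rewrite (le_trans _ (bound P R psi h)) // rmorphN -normrN ler_norm.
Qed.

Lemma ideal_sum_radical f g c n : ideal_sum f g (c ^+ n) -> ideal_sum f g c.
Proof.
apply: (sqr_closed_radical (ideal_sum_ideal f g)) => y; exact: ideal_sum_sqr.
Qed.

(** On the primes that contain both [Y x] and [Y y], the solutions [x] and [y]
agree, so [x - y = i + j] in the sum of the two ideals; [x - i = y + j] is then
a solution wherever [x] or [y] is. *)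
Lemma glue2 x y : exists z, forall P, prime_ideal P -> P (Y x) \/ P (Y y) -> P (Y z).
Proof.
have [|n /ideal_sum_radical [i [j [hi hj xyE]]]] :=
    primes_radical (x := x - y) (ideal_sum_ideal (Y x) (Y y)).
  move=> P hP hPI; apply: (Y_uniq hP); apply: hPI.
    exists (Y x), 0; rewrite addr0; split=> //; exact: (ideal0 (vanishing_ideal _)).
  exists 0, (Y y); rewrite add0r; split=> //; exact: (ideal0 (vanishing_ideal _)).
exists (x - i) => P hP [Px|Py].
  by apply: (Y_ext hP _ Px); rewrite opprB addrC subrK; exact: hi.
apply: (Y_ext hP _ Py).
have -> : y - (x - i) = (-1) * j by rewrite -(subrK y x) xyE; ring.
by apply: (prime_idealM hP); exact: hj.
Qed.

Lemma glue_seq (s : seq A) : exists z, forall P, prime_ideal P ->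
  P (\prod_(x <- s) Y x) -> P (Y z).
Proof.
elim: s => [|x s [z hz]].
  by exists 0 => P hP; rewrite big_nil => /(prime_ideal1 hP).
have [w hw] := glue2 x z; exists w => P hP; rewrite big_cons.
move=> /(prime_ideal_prime hP) h; apply: (hw P hP).
by case: h => [|/(hz P hP)]; [left|right].
Qed.

(** If no finite product of values of [Y] vanishes, a prime ideal avoids all of
them, against [Y_ex]. *)
Lemma glue : exists z, Y z = 0.
Proof.
have [[s sE]|none] := pselect (exists s : seq A, \prod_(x <- s) Y x = 0).
  have [z hz] := glue_seq s; exists z; apply: (reduced_primes0 red) => P hP.
  by apply: hz => //; rewrite sE; exact: (prime_ideal0 hP).
have [||||P [hP _ PS]] := @prime_avoiding A [set 0]
    [set a | exists s : seq A, a = \prod_(x <- s) Y x].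
- exact: zero_is_ideal.
- by exists [::]; rewrite big_nil.
- by move=> _ _ [s ->] [t ->]; exists (s ++ t); rewrite big_cat.
- by move=> _ -> [s sE]; apply: none; exists s.
have [x Px] := Y_ex hP; exfalso; apply: (PS _ _ Px).
by exists [:: x]; rewrite big_seq1.
Qed.

End Gluing.

Local Notation vrootsA := (@vroots A (fle v 0)).
Local Notation condsK := (all_pos (fun u => 0 <= u)).

Lemma vroots_place (R : rcfType) (psi : {rmorphism A -> R}) d (a : d.-tuple A) rs :
  vrootsA a rs -> vroots (fun u : R => 0 <= u) (map_tuple psi a) (map psi rs).
Proof. by apply: vroots_map => u; exact: place_ge0. Qed.

(** [Y x] is in [P] iff the image of [x] in the real closed field at [P] is the
virtual root. *)
Lemma vroot_exists_ring n (a : n.+1.-tuple A) b ss j : is_mpderiv a b ->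
  vrootsA b ss -> (j <= n)%N -> exists x, all_pos (fle v 0) (vroot_conds a ss j x).
Proof.
move=> ab hb jn; pose Y x := defect v (vroot_conds a ss j x).
have YP P x (R : rcfType) (psi : {rmorphism A -> R}) : prime_ideal P -> real_place P psi ->
    P (Y x) <-> condsK (vroot_conds (map_tuple psi a) (map psi ss) j (psi x)).
  by move=> hP hpsi; rewrite (defect_place _ hP hpsi) vroot_conds_map.
have [|||x Yx] := @glue Y.
- move=> P hP; have [R [psi hpsi]] := exists_real_place hP.
  have [z hz zss] := vroot_exists (is_mpderiv_map psi ab) (vroots_place psi hb) jn.
  have [x xE] : exists x, psi x = z.
    case: zss => [/mapP[x _ ->]|/(real_place_integral hpsi)//]; by exists x.
  by exists x; apply/(YP _ _ _ _ hP hpsi); rewrite xE.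
- move=> P x y hP; have [R [psi hpsi]] := exists_real_place hP.
  move=> /(YP _ _ _ _ hP hpsi) hx /(YP _ _ _ _ hP hpsi) hy.
  apply/(real_place_eq0 hpsi); rewrite rmorphB; apply/eqP; rewrite subr_eq0; apply/eqP.
  have sg := vroots_cell_signs (@ivt_rcf R n) (vroots_place psi hb).
  exact: (vroot_uniq (is_mpderiv_map psi ab) sg (@ivt_rcf R _) jn hx hy).
- move=> P x y hP; have [R [psi hpsi]] := exists_real_place hP.
  move=> /(real_place_eq0 hpsi)/eqP; rewrite rmorphB subr_eq0 => /eqP xy.
  by move=> /(YP _ _ _ _ hP hpsi); rewrite xy => /(YP _ _ _ _ hP hpsi).
exists x => u hu; apply/(npart_eq0 fr); apply: (reduced_primes0 red) => P hP.
have := defect_prime fr (vroot_conds a ss j x) hP (fun a b => prime_convex cvx hP).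
rewrite -/(Y x) Yx => -[/(_ (prime_ideal0 hP)) h _]; exact: h.
Qed.

Lemma is_mpderiv_uniq_ring n (a : n.+1.-tuple A) b b' :
  is_mpderiv a b -> is_mpderiv a b' -> b = b'.
Proof.
move=> h h'; apply: eq_from_tnth => i; apply: pointwise_eq => P R psi _.
have := is_mpderiv_uniq (is_mpderiv_map psi h) (is_mpderiv_map psi h').
by move=> /(congr1 (fun t => tnth t i)); rewrite !tnth_map.
Qed.

Lemma vroots_uniq_ring d (a : d.-tuple A) rs rs' :
  vrootsA a rs -> vrootsA a rs' -> rs = rs'.
Proof.
move=> h h'; apply: (@eq_from_nth _ 0); first by rewrite (size_vroots h) (size_vroots h').
move=> i irs; apply: pointwise_eq => P R psi _.
rewrite -!(nth_map _ 0 psi) //; last by rewrite (size_vroots h') -(size_vroots h).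
by rewrite (vroots_uniq (@ivt_rcf R d) (vroots_place psi h) (vroots_place psi h')).
Qed.

Variable Fr : A -> A -> A.
(** [mpderiv] only refers to the fractions, so the root functions are arbitrary
here. *)
Let S0 := ArcOps v Fr (fun d (i : 'I_d) (a : d.-tuple A) => 0).
Hypothesis hFr : fractions_axiom S0.

Lemma is_mpderiv_exists n (a : n.+1.-tuple A) : exists b, is_mpderiv a b.
Proof.
case: n a => [|n] a; first by exists [tuple] => -[].
by exists (mpderiv S0 a); exact: is_mpderiv_mpderiv.
Qed.

Lemma vroots_exist d (a : d.-tuple A) : exists rs, vrootsA a rs.
Proof.
elim: d a => [|n IH] a; first by exists [::].
have [b ab] := is_mpderiv_exists a; have [ss hb] := IH b.
have H j : exists x, (j < n.+1)%N -> all_pos (fle v 0) (vroot_conds a ss j x).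
  have [jn|_] := ltnP j n.+1; last by exists 0.
  by have [x hx] := vroot_exists_ring ab hb jn; exists x.
exists (mkseq (fun j => projT1 (cid (H j))) n.+1); split; first by rewrite size_mkseq.
exists b, ss; split=> // j jn; rewrite nth_mkseq //.
by case: cid => x /= /(_ jn).
Qed.

Definition vroot_seq d (a : d.-tuple A) : seq A := projT1 (cid (vroots_exist a)).

Lemma vroot_seqP d (a : d.-tuple A) : vrootsA a (vroot_seq a).
Proof. by rewrite /vroot_seq; case: cid. Qed.

Definition schwartz_ops : arc_ops A :=
  ArcOps v Fr (fun d (i : 'I_d) a => nth 0 (vroot_seq a) i).

(** By uniqueness, the sequences in the definition of [vroots] are the chosen ones. *)
Lemma schwartz_vroot_conds n (a : n.+1.-tuple A) b (i : 'I_n.+1) : is_mpderiv a b ->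
  all_pos (fle v 0) (vroot_conds a (vroot_seq b) i (rho schwartz_ops i a)).
Proof.
move=> ab; have /= [_ [b' [ss [ab' hb' h]]]] := vroot_seqP a.
rewrite (is_mpderiv_uniq_ring ab ab').
by rewrite (vroots_uniq_ring (vroot_seqP b') hb'); exact: h.
Qed.

Lemma onth_vroot_seq d (a : d.-tuple A) (i : 'I_d) :
  onth (vroot_seq a) i = Some (rho schwartz_ops i a).
Proof. by rewrite (onth_ltn 0) // (size_vroots (vroot_seqP a)). Qed.

Lemma onth_vroot_seq_size d (a : d.-tuple A) : onth (vroot_seq a) d = None.
Proof. by rewrite onth_default // (size_vroots (vroot_seqP a)). Qed.

Lemma schwartz_vroot1 : vroot1_axiom schwartz_ops.
Proof.
move=> a; have ab : is_mpderiv [tuple a] [tuple] by case.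
have := schwartz_vroot_conds (i := ord0) ab; set x := rho _ _ _.
have fE : mpeval [tuple a] x = x - a.
  by rewrite /mpeval big_ord1 /= subnn expr0 expr1 mulr1.
rewrite /vroot_conds [onth _ _](onth_vroot_seq_size [tuple]) subn0 expr0.
move=> /all_pos_cat[/all_pos1 + /all_pos1].
rewrite mul1r fE => /(fle_oppr fr) h1 h2.
by apply/eqP; rewrite -subr_eq0; apply/eqP; exact: (fle_anti fr).
Qed.

(** In a real closed field, the larger of [a] and [b] satisfies the conditions on
the last virtual root of [(X - a) (X - b)], with lower end the mean of [a] and
[b]. *)
Lemma schwartz_vrsup : vrsup_axiom schwartz_ops.
Proof.
move=> a b; set p := [tuple a + b; - (a * b)].
have pq : is_mpderiv p (mpderiv S0 p) by exact: is_mpderiv_mpderiv.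
have [c cE] : exists c, mpderiv S0 p = [tuple c].
  by exists (tnth (mpderiv S0 p) ord0); apply: eq_from_tnth => i; rewrite ord1.
rewrite cE in pq; have c2 : 2 * c = a + b.
  by have := pq ord0; rewrite !(tnth_nth 0) /= mul1r.
have loE : onth (vroot_seq [tuple c]) 0 = Some c.
  by rewrite [onth _ _](onth_vroot_seq [tuple c] ord0) schwartz_vroot1.
have hiE := onth_vroot_seq_size [tuple c].
have hx := schwartz_vroot_conds (i := ord_max) pq.
apply: pointwise_eq => P R psi _.
have sg := vroots_cell_signs (@ivt_rcf R 1) (vroots_place psi (vroot_seqP [tuple c])).
apply: (vroot_uniq (is_mpderiv_map psi pq) sg (@ivt_rcf R _) (j := 1)) => //.
  rewrite -vroot_conds_map => _ /mapP[u hu ->]; apply: place_ge0; exact: hx.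
rewrite /vroot_conds lo_bound_map onth_map [lo_bound _ _]loE hiE place_vee /= expr0.
have c2E : 2 * psi c = psi a + psi b by rewrite -rmorphD -c2 rmorphM rmorph_nat.
have fE z : mpeval (map_tuple psi p) z = (z - psi a) * (z - psi b).
  rewrite /mpeval big_ord_recr big_ord1 !tnth_map !(tnth_nth 0) /=.
  by rewrite rmorphN rmorphM rmorphD expr1 expr0; ring.
move: (psi a) (psi b) (psi c) c2E fE => s t g c2E fE.
have f0 : mpeval (map_tuple psi p) (Num.max s t) = 0.
  by rewrite fE; case: (lerP s t) => _; rewrite subrr ?mulr0 ?mul0r.
apply/all_pos_cat; split; last by apply/all_pos1; rewrite f0 mulr0.
apply/all_pos3; rewrite f0 mulr0 oppr0 mul1r fE.
have max_ge : 0 <= Num.max s t - g by have [st|st] := lerP s t; lra.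
split=> //=; rewrite oppr_ge0 mulr_ge0_le0 //.
have -> : g - t = - (g - s) by lra.
by rewrite mulrN oppr_le0 -expr2 sqr_ge0.
Qed.

Lemma schwartz_model : is_arc_model schwartz_ops.
Proof.
have hFr' : fractions_axiom schwartz_ops by exact: hFr.
have derP n (a : n.+2.-tuple A) : is_mpderiv a (mpderiv schwartz_ops a).
  exact: is_mpderiv_mpderiv.
have subP x y : le 0 (y - x) -> le x y := (fle_subr fr x y).2.
have NP x : le 0 (- x) -> le x 0 := (fle_oppr fr x).1.
split; [exact: fr|exact: hFr'|exact: schwartz_vrsup|exact: schwartz_vroot1| | |].
- move=> n a i /andP[i0 im] f x s alpha beta.
  have := schwartz_vroot_conds (i := i) (derP n a).
  have -> : vroot_conds a (vroot_seq (mpderiv schwartz_ops a)) i (rho schwartz_ops i a)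
    = cell_conds s f (Some alpha) (Some beta) x.
    congr cell_conds; last by rewrite -onth_vroot_seq inordK.
    rewrite /alpha -onth_vroot_seq inordK; last by apply: leq_ltn_trans im; exact: leq_pred.
    by case: (i : nat) i0.
  by move=> /all_pos_cat[/all_pos3[/subP h1 /NP h2 /NP h3] /all_pos3[/subP h4 h5 h6]].
- move=> n a f x alpha.
  have := schwartz_vroot_conds (i := ord_max) (derP n a).
  have -> : vroot_conds a (vroot_seq (mpderiv schwartz_ops a)) (ord_max : 'I_n.+2)
     (rho schwartz_ops ord_max a) = cell_conds 1 f (Some alpha) None x.
    rewrite /vroot_conds subnn expr0; congr cell_conds.
      exact: (onth_vroot_seq _ ord_max).
    exact: onth_vroot_seq_size.
  move=> /all_pos_cat[/all_pos3[/subP h1 + +] /all_pos1].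
  by rewrite !mul1r => /NP h2 /NP h3 h4.
move=> n a f x s beta.
have := schwartz_vroot_conds (i := ord0) (derP n a).
have -> : vroot_conds a (vroot_seq (mpderiv schwartz_ops a)) (ord0 : 'I_n.+2)
   (rho schwartz_ops ord0 a) = cell_conds s f None (Some beta) x.
  rewrite /vroot_conds subn0; congr cell_conds.
  exact: (onth_vroot_seq _ ord0).
by move=> /all_pos_cat[/all_pos1/NP h1 /all_pos3[/subP h4 h5 h6]].
Qed.

End Schwartz.

Lemma schwartz_arc (A : comPzRingType) : schwartz_real_closed A ->
  exists S : arc_ops A, is_arc_model S.
Proof.
case=> red [le [[_ [v fr leE]] sq cvx]] residues.
have sqP x : fle v 0 x <-> exists y, x = y ^+ 2 by rewrite -leE.
have cvx' a b : fle v 0 a -> fle v a b -> exists z, z * b = a ^+ 2.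
  by move=> /leE a0 /leE; exact: cvx.
have [Fr hFr] := fractions_exist red fr sqP cvx' residues.
by exists (schwartz_ops red fr sqP cvx' residues hFr); exact: schwartz_model.
Qed.

Theorem mainTheorem1 (A : comPzRingType) :
  (exists S : arc_ops A, is_arc_model S) <-> schwartz_real_closed A.
Proof. by split=> [[S]|]; [exact: arc_schwartz|exact: schwartz_arc]. Qed.
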